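(* Let $M$ be a connected compact topological manifold, possibly with boundary, and let $\varphi$ be a continuous flow on $M$. For any open face $F$ of $\mathrm{QL}_\varphi$ there exists a $\varphi$-invariant compact subset $\mathcal R_F\subset M$, possibly empty, such that the following hold: (1) for any open face $F$ of $\mathrm{QL}_\varphi$ and any $\alpha\in F$, we have $\mathcal R_\alpha=\mathcal R_F$; (2) for any two open faces $F_1,F_2$ of $\mathrm{QL}_\varphi$, we have $F_1\subset\overline{F_2}$ if and only if $\mathcal R_{F_2}\subset\mathcal R_{F_1}$; (3) as a consequence, $\mathcal R_{F_1}=\mathcal R_{F_2}$ implies $F_1=F_2$, and $F_1\subset\partial F_2$ implies $\mathcal R_{F_2}\subsetneq\mathcal R_{F_1}$.
   Context: Flows are defined for all times; $M$ carries a metric compatible with its topology. Coverings. $\widehat M\to M$ is the universal Abelian covering of $M$; its deck group is $H_1(M,\mathbb Z)$, and the action is written $\delta\cdot x$. A class $\alpha\in H^1(M,\mathbb R)$ is viewed as a homomorphism $H_1(M,\mathbb Z)\to\mathbb R$, with kernel $\ker_{\mathbb Z}(\alpha)$. Set $\widehat M_\alpha=\widehat M/\ker_{\mathbb Z}(\alpha)$, a covering $\pi_\alpha\colon\widehat M_\alpha\to M$. The flow lifts to $\widehat M$ and $\widehat M_\alpha$. Covering spaces of $M$ carry a metric invariant under deck transformations for which the projection to $M$ restricted to every ball of sufficiently small radius is an isometry onto its image. A function $f$ on $\widehat M$ is $\alpha$-equivariant if $f(\delta\cdot x)=f(x)+\alpha(\delta)$ for all $\delta\in H_1(M,\mathbb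 Z)$ and all $x$. Pseudo-orbits. Let $N$ be $M$ or one of these coverings, with its flow $\psi$ and metric $d$, and fix $T>0$. For $\epsilon>0$, an $\epsilon$-pseudo-orbit is a right-continuous map $\gamma\colon[0,l)\to N$, $l>0$ (the length $\mathrm{len}(\gamma)$), continuous outside a finite set $\Delta\subset[T,l)$ whose distinct points are at distance at least $T$ from each other, such that $\gamma(s)=\psi_{s-t}(\gamma(t))$ whenever $\gamma$ is continuous on $[t,s]$, and $d(\gamma(u),\gamma(u^-))<\epsilon$ for $u\in\Delta$, where $\gamma(u^-)=\lim_{t\to u^-}\gamma(t)$. It goes from $\gamma(0)$ to $\gamma(l^-)$. Write $x\rightsquigarrow y$ if for every $\epsilon>0$ there is an $\epsilon$-pseudo-orbit from $x$ to $y$. A point $x$ is recurrent if $x\rightsquigarrow x$. $\mathcal R_\alpha\subset M$ (the $\alpha$-recurrent set) is the image under $\pi_\alpha$ of the set of recurrent points of the lifted flow on $\widehat M_\alpha$; equivalently, $x\in\mathcal R_\alpha$ iff for every small $\epsilon>0$ and every $T>0$ there is a periodic $\epsilon$-pseudo-orbit through $x$ whose homology class is in the kernel of $\alpha$. A continuous $\alpha$-equivariant map $f\colon\widehat M\to\mathbb R$ is quasi-Lyapunov if there are $C\ge0$ and $\epsilon>0$ such that $f(\gamma(0))\ge f(\gamma(t))-C$ for every $\epsilon$-pseudo-orbit $\gamma$ in $\widehat M$ and every $t\in[0,\mathrm{len}(\gamma))$. The class $\alpha$ is quasi-Lyapunov if every continuous $\alpha$-equivariant map $\widehat M\to\mathbb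 R$ is quasi-Lyapunov. $\mathrm{QL}_\varphi\subset H^1(M,\mathbb R)$ is the set of quasi-Lyapunov classes; it is a convex cone containing $0$, not necessarily closed. Open faces. Let $\mathcal C$ be a non-empty convex cone in a finite-dimensional real vector space, and let $\langle E\rangle$ denote the linear span of $E$. An open face of $\mathcal C$ is a non-empty subset $F\subset\mathcal C$ which is a convex cone (convex, stable under multiplication by positive scalars), is open in $\langle F\rangle$, and is maximal for inclusion among the subsets of $\mathcal C$ with these two properties. $\overline F$ is the closure of $F$ and $\partial F=\overline F\setminus F$ its boundary in $\langle F\rangle$. *)

(* Defs.v *)
From HB Require Import structures.
From mathcomp Require Import all_boot all_order all_algebra.
From mathcomp Require Import all_classical all_reals all_analysis.
From mathcomp Require Import freeg.
From mathcomp Require Import generic_quotient.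

Set Implicit Arguments.
Unset Strict Implicit.
Unset Printing Implicit Defensive.

Import Order.TTheory GRing.Theory Num.Theory.
Import numFieldNormedType.Exports.

Local Open Scope classical_set_scope.
Local Open Scope ring_scope.
Local Open Scope quotient_scope.

Section Faces.
Context {R : realType} {V : preTopologicalLmodType R}.
Implicit Types C E F G : set V.

Definition convex_cone C :=
  convex_set (C : set (convex_lmodType V)) /\
  forall (a : R) (x : V), 0 < a -> C x -> C (a *: x).

Definition linear_span E : set V :=
  [set x | exists (n : nat) (a : 'I_n -> R) (e : 'I_n -> V),
     (forall i, E (e i)) /\ x = \sum_(i < n) a i *: e i].

Definition open_in_span F := exists2 U, open U & F = U `&` linear_span F.

Definition open_subcone C F :=
  [/\ F !=set0, F `<=` C, convex_cone F & open_in_span F].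

Definition open_face C F :=
  open_subcone C F /\ forall G, open_subcone C G -> F `<=` G -> G = F.

Definition face_boundary F : set V := closure F `\` F.

End Faces.

(** For [n = 0] there is no coordinate to constrain and [half_space] is all
    of [R^0]. *)
Definition half_space (R : realType) (n : nat) : set 'rV[R]_n :=
  [set x | forall i : 'I_n, val i = 0%N -> 0 <= x ord0 i].
Arguments half_space R n : clear implicits.

Definition topological_manifold (R : realType) (M : topologicalType) :=
  [/\ hausdorff_space M, @second_countable M &
   exists n : nat, forall x : M,
     exists (U : set M) (f : M -> 'rV[R]_n) (g : 'rV[R]_n -> M),
       [/\ open_nbhs x U,
           exists2 V : set 'rV[R]_n, open V & f @` U = V `&` half_space R n,
           {within U, continuous f}, {within f @` U, continuous g} &
           {in U, cancel f g}]].

Definition std_simplex (R : realType) (n : nat) : set 'rV[R]_n.+1 :=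
  [set x | (forall i, 0 <= x ord0 i) /\ \sum_i x ord0 i = 1].
Arguments std_simplex R n : clear implicits.

Section Singular.
Variable R : realType.

Lemma vertex_subproof n (i : 'I_n.+1) :
  (delta_mx ord0 i : 'rV[R]_n.+1) \in std_simplex R n.
Proof.
apply/mem_set; split=> [j|]; first by rewrite mxE ler0n.
rewrite (bigD1 i) //= mxE !eqxx big1 ?addr0 // => j /negbTE ji.
by rewrite mxE ji andbF.
Qed.

Definition vertex n (i : 'I_n.+1) : std_simplex R n :=
  @exist _ (fun x => x \in std_simplex R n) _ (vertex_subproof i).

Definition coface_row n (i : 'I_n.+2) (x : 'rV[R]_n.+1) : 'rV[R]_n.+2 :=
  \row_j oapp (x ord0) 0 (unlift i j).

Lemma coface_row_simplex n (i : 'I_n.+2) (x : std_simplex R n) :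
  coface_row i (set_val x) \in std_simplex R n.+1.
Proof.
case: x => x xS; rewrite set_valE /=; move/set_mem: (xS) => [x0 x1].
apply/mem_set; split.
  by move=> j; rewrite mxE; case: unlift => //= k.
rewrite -x1 (bigD1_ord i) //= mxE unlift_none /= add0r.
by apply: eq_bigr => j _; rewrite mxE liftK.
Qed.

Definition coface n (i : 'I_n.+2) (x : std_simplex R n) : std_simplex R n.+1 :=
  @exist _ (fun y => y \in std_simplex R n.+1) _ (coface_row_simplex i x).

Lemma coface_continuous n (i : 'I_n.+2) : continuous (@coface n i).
Proof.
apply/continuous_comp_initial => x.
apply: (@continuous_comp _ _ _ set_val (@coface_row n i)).
  exact: initial_continuous.
move=> A /nbhs_ballP [e /= e0 eA]; apply/nbhs_ballP; exists e => //= y [_ xy].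
apply: eA; split=> // k j; rewrite !mxE.
case: unliftP => [l _|_] /=; last exact: ballxx.
exact: xy.
Qed.

HB.instance Definition _ n (i : 'I_n.+2) :=
  isContinuous.Build _ _ (@coface n i) (@coface_continuous n i).

Variable M : topologicalType.

Definition singular (n : nat) := continuousType (std_simplex R n) M.

Definition face n (i : 'I_n.+2) (s : singular n.+1) : singular n :=
  (s : std_simplex R n.+1 -> M) \o coface i.

Definition chain (n : nat) := {freeg (singular n)}.

Definition simplex_boundary n (s : singular n.+1) : chain n :=
  \sum_(i < n.+2) (-1) ^+ i *: << face i s >>.

Definition boundary n : chain n.+1 -> chain n := fglift (@simplex_boundary n).

HB.instance Definition _ n := GRing.isZmodMorphism.Build (chain n.+1) (chain n)
  (@boundary n) (lift_is_additive (@simplex_boundary n)).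

Definition is_cycle : {pred chain 1} := fun c => boundary c == 0.

Lemma is_cycle_zmod_closed : zmod_closed is_cycle.
Proof.
split=> [|x y]; rewrite !unfold_in /is_cycle ?raddf0 // raddfB /=.
by move=> /eqP -> /eqP ->; rewrite subrr.
Qed.
HB.instance Definition _ :=
  GRing.isZmodClosed.Build (chain 1) is_cycle is_cycle_zmod_closed.

Record cycle1 := Cycle1 { cycle_chain : chain 1; _ : is_cycle cycle_chain }.
HB.instance Definition _ := [isSub for cycle_chain].
HB.instance Definition _ := [Choice of cycle1 by <:].
HB.instance Definition _ := [SubChoice_isSubZmodule of cycle1 by <:].

Definition is_boundary : {pred cycle1} :=
  fun z => `[< exists c : chain 2, val z = boundary c >].

Lemma is_boundary_zmod_closed : zmod_closed is_boundary.
Proof.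
split=> [|x y]; rewrite !unfold_in /is_boundary.
  by apply/asboolP; exists 0; rewrite !raddf0.
move=> /asboolP [c xc] /asboolP [d yd]; apply/asboolP; exists (c - d).
by rewrite !raddfB /= xc yd.
Qed.
HB.instance Definition _ :=
  GRing.isZmodClosed.Build cycle1 is_boundary is_boundary_zmod_closed.

Definition H1Z := Quotient.quot is_boundary.

(** [loop_class s delta]: the singular 1-simplex [s] is a loop (a cycle) and
    its homology class is [delta]. *)
Definition loop_class (s : singular 1) (delta : H1Z) :=
  exists2 z : cycle1, val z = << s >> & \pi_H1Z z = delta.

(** By universal coefficients, [H^1(M, R)] is the space of homomorphisms
    [H_1(M, Z) -> R]. *)
Definition is_hom : {pred H1Z -> R} :=
  fun a => `[< {morph a : x y / x + y} >].

Lemma is_hom_submod_closed : GRing.submod_closed is_hom.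
Proof.
split=> [|k a b]; rewrite !unfold_in /is_hom.
  by apply/asboolP=> x y; rewrite addr0.
move=> /asboolP ha /asboolP hb; apply/asboolP=> x y.
by rewrite !fctE ha hb scalerDr addrACA.
Qed.
HB.instance Definition _ :=
  GRing.isSubmodClosed.Build R (H1Z -> R) is_hom is_hom_submod_closed.

Record H1R := HomH1R { class_fun :> H1Z -> R; _ : is_hom class_fun }.
HB.instance Definition _ := [isSub for class_fun].
HB.instance Definition _ := [Choice of H1R by <:].
HB.instance Definition _ := [SubChoice_isSubLmodule of H1R by <:].

(** Topology of pointwise convergence.  When [M] is a compact manifold,
    [H_1(M, Z)] is finitely generated, and this is the usual topology of the
    finite-dimensional vector space [H^1(M, R)]. *)
HB.instance Definition _ := Topological.copy H1R
  (initial_topology (class_fun : H1R -> {ptws H1Z -> R})).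

End Singular.

Definition is_flow (R : realType) (N : topologicalType) (psi : R -> N -> N) :=
  [/\ continuous (fun z : R * N => psi z.1 z.2),
      forall x, psi 0 x = x &
      forall s t x, psi (s + t) x = psi s (psi t x)].

Definition compatible_metric (R : realType) (N : topologicalType)
    (d : N -> N -> R) :=
  [/\ forall x y, 0 <= d x y,
      forall x y, d x y = 0 <-> x = y,
      forall x y, d x y = d y x,
      forall x y z, d x z <= d x y + d y z &
      forall x (A : set N),
        nbhs x A <-> exists2 e : R, 0 < e & [set y | d x y < e] `<=` A].

Section PseudoOrbits.
Context {R : realType} {N : topologicalType}.
Variables (psi : R -> N -> N) (d : N -> N -> R) (T : R).

(** A map [[0, l) -> N] is encoded by a total function [gam : R -> N] whose
    values outside [[0, l)] are irrelevant. *)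
Definition pseudo_orbit (eps l : R) (gam : R -> N) :=
  [/\ 0 < l,
      forall t, 0 <= t < l -> gam x @[x --> t^'+] --> gam t,
      forall s t, 0 <= t <= s -> s < l ->
        {within `[t, s], continuous gam} -> gam s = psi (s - t) (gam t) &
      exists D : set R,
        [/\ finite_set D, D `<=` `[T, l[,
            forall u v, D u -> D v -> u <> v -> T <= `|u - v|,
            forall t, 0 <= t < l -> ~ D t ->
              gam x @[x --> within `[0, l[ (nbhs t)] --> gam t &
            forall u, D u ->
              exists2 z, gam x @[x --> u^'-] --> z & d (gam u) z < eps]].

Definition leads_to (x y : N) :=
  forall eps : R, 0 < eps -> exists (l : R) (gam : R -> N),
    [/\ pseudo_orbit eps l gam, gam 0 = x & gam t @[t --> l^'-] --> y].

Definition recurrent : set N := [set x | leads_to x x].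

End PseudoOrbits.

Definition evenly_covered (N M : topologicalType) (p : N -> M) (U : set M) :=
  exists S : set (set N),
    [/\ trivIset S id, \bigcup_(W in S) W = p @^-1` U &
        forall W, S W ->
          [/\ open W, set_bij W U p, {within W, continuous p} &
              forall O, open O -> O `<=` W -> open (p @` O)]].

Definition covering_map (N M : topologicalType) (p : N -> M) :=
  [/\ continuous p, set_surj setT setT p &
      forall x, exists2 U, open_nbhs x U & evenly_covered p U].

Definition deck_transformation (N M : topologicalType) (p : N -> M)
    (g : N -> N) :=
  [/\ continuous g, p \o g = p &
      exists h, [/\ continuous h, cancel g h & cancel h g]].

Definition covering_metric (R : realType) (N M : topologicalType) (p : N -> M)
    (dM : M -> M -> R) (dN : N -> N -> R) :=
  [/\ compatible_metric dN,
      forall g, deck_transformation p g ->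
        forall x y, dN (g x) (g y) = dN x y &
      exists2 r, 0 < r & forall x y z, dN x y < r -> dN x z < r ->
        dM (p y) (p z) = dN y z].

Definition lifted_flow (R : realType) (N M : topologicalType) (p : N -> M)
    (phi : R -> M -> M) (psi : R -> N -> N) :=
  is_flow psi /\ forall t x, p (psi t x) = phi t (p x).

(** The universal Abelian covering is the connected covering on which the
    monodromy of a loop is its class in [H_1(M, Z)]: it corresponds to the
    kernel of [pi_1(M) -> H_1(M, Z)], the commutator subgroup. The last field
    identifies its deck group with [H_1(M, Z)]: a path in the covering that
    projects to a loop of class [delta] goes from some [x] to [delta . x]. *)
Record universal_abelian_covering (R : realType) (M : topologicalType) := {
  uac_space :> topologicalType;
  uac_proj : uac_space -> M;
  uac_act : H1Z R M -> uac_space -> uac_space;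
  uac_connected : connected [set: uac_space];
  uac_covering : covering_map uac_proj;
  uac_act0 : forall x, uac_act 0 x = x;
  uac_actD : forall a b x, uac_act (a + b) x = uac_act a (uac_act b x);
  uac_act_continuous : forall a, continuous (uac_act a);
  uac_act_proj : forall a x, uac_proj (uac_act a x) = uac_proj x;
  uac_act_free : forall a x, uac_act a x = x -> a = 0;
  uac_act_trans : forall x y, uac_proj x = uac_proj y ->
    exists a, y = uac_act a x;
  uac_monodromy : forall (c : singular R uac_space 1) (s : singular R M 1)
      (a : H1Z R M),
    (forall t, uac_proj (c t) = s t) -> loop_class s a ->
    c (vertex R ord_max) = uac_act a (c (vertex R ord0))
}.

Section AlphaCovering.
Context {R : realType} {M : topologicalType}.
Variables (E : universal_abelian_covering R M) (alpha : H1R R M).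

Definition ker_orbit : rel E :=
  fun x y => `[< exists2 a, alpha a = 0 & y = uac_act a x >].

Lemma ker_orbit_equiv : equiv_class_of ker_orbit.
Proof.
have alphaD x y : alpha (x + y) = alpha x + alpha y.
  by case: (alpha) => a /= /asboolP; exact.
have alpha0 : alpha 0 = 0.
  by apply: (addrI (alpha 0)); rewrite -alphaD !addr0.
have sym x y : ker_orbit x y -> ker_orbit y x.
  move=> /asboolP [a a0 ->]; apply/asboolP; exists (- a).
    by apply: (addrI (alpha a)); rewrite -alphaD subrr alpha0 a0 addr0.
  by rewrite -uac_actD addNr uac_act0.
split=> [x|x y|y x z].
- by apply/asboolP; exists 0; rewrite ?uac_act0.
- by apply/idP/idP; exact: sym.
- move=> /asboolP [a a0 ->] /asboolP [b b0 ->]; apply/asboolP.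
  by exists (b + a); rewrite ?uac_actD // alphaD a0 b0 addr0.
Qed.

Canonical ker_orbit_equiv_rel := EquivRelPack ker_orbit_equiv.

(** [Mhat / ker_Z(alpha)] with the quotient topology. *)
Definition alpha_covering : topologicalType :=
  quotient_topology {eq_quot ker_orbit}.

(** Independent of the representative, since the action preserves fibres. *)
Definition alpha_proj (x : alpha_covering) : M :=
  uac_proj (repr (x : {eq_quot ker_orbit})).

End AlphaCovering.

Definition alpha_recurrent (R : realType) (M : topologicalType)
    (E : universal_abelian_covering R M) (alpha : H1R R M)
    (psi : R -> alpha_covering E alpha -> alpha_covering E alpha)
    (d : alpha_covering E alpha -> alpha_covering E alpha -> R) (T : R)
    : set M :=
  @alpha_proj R M E alpha @` recurrent psi d T.

Section QuasiLyapunov.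
Context {R : realType} {M : topologicalType}.
Variables (E : universal_abelian_covering R M).
Variables (psi : R -> E -> E) (d : E -> E -> R) (T : R).

Definition equivariant (alpha : H1R R M) (f : E -> R) :=
  forall a x, f (uac_act a x) = f x + alpha a.

Definition quasi_Lyapunov_map (f : E -> R) :=
  exists C eps : R, [/\ 0 <= C, 0 < eps &
    forall l gam, pseudo_orbit psi d T eps l gam ->
      forall t, 0 <= t < l -> f (gam t) - C <= f (gam 0)].

Definition quasi_Lyapunov : set (H1R R M) :=
  [set alpha | forall f : E -> R, continuous f -> equivariant alpha f ->
     quasi_Lyapunov_map f].

End QuasiLyapunov.

(* Main.v *)
(* A class [al] is quasi-Lyapunov iff, for some [eps], it is nonpositive on the
   homology classes of all periodic [eps]-pseudo-orbits; this follows by splitting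
   long pseudo-orbits into simple cycles of a finite graph, and uses that every
   class has a continuous equivariant primitive. Likewise, [x] is [al]-recurrent
   iff for every [eps] some periodic [eps]-pseudo-orbit through [x] has an
   [al]-null class.

   The heart of the matter is that, for quasi-Lyapunov [al] and [be], the recurrent
   set of [be] is contained in that of [al] iff [be - s al] is quasi-Lyapunov for
   some [s > 0]. If it is, a [be]-null cycle is [al]-null by nonpositivity. For the
   converse, near the [al]-recurrent set chains can be reversed by [al]-null chains,
   so [be]-null cycles of small error are [al]-null; on the finitely many simple
   cycles of a fine graph, [al] is then dominated by a multiple of [be].

   In the cone of quasi-Lyapunov classes, the open face containing [be] consists of
   the [x] such that [be - s x] and [x - s be] lie in the cone for some [s > 0], so
   the inclusions between faces translate into inclusions of recurrent sets. *)

Require Import Defs.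
From mathcomp Require Import all_boot all_order all_algebra.
From mathcomp Require Import all_classical all_reals all_analysis.
From mathcomp Require Import ring lra.

Import Order.TTheory GRing.Theory Num.Theory.
Import numFieldNormedType.Exports.
Local Open Scope classical_set_scope.
Local Open Scope ring_scope.

(** * Pseudo-orbits and chains *)

(** The sets [Ralpha al] are defined in coverings that change with [al], so everything is moved to
    the universal Abelian covering, where the class of a periodic pseudo-orbit is the [a] for which
    a lift goes from [x] to [act a x]. Estimates need uniform continuity of the flow over bounded
    times, and a finite graph needs finitely many labels, so steps are cut to flow times in
    [[T, 2T]]. The final segment of a pseudo-orbit may last less than [T] and is not a step: it has
    to be absorbed by the step before it, repeated, or bounded by the drift of [f]. Likewise,
    reversing a step of time at most [2T] along a recurrent orbit must leave at least [T] of flow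
    before the next jump, whence the bound [3T] on first flow times. Finite generation of [H_1],
    obtained from the cocompact action on a connected space, makes finitely many evaluations
    separate classes and so provides coordinates for the faces. *)

Section Metric.
Context {R : realType} {N : topologicalType} {d : N -> N -> R}.
Hypothesis dP : compatible_metric d.

Lemma metric_refl x : d x x = 0.
Proof. by case: dP => _ d0 _ _ _; apply/d0. Qed.

Lemma metric_sym x y : d x y = d y x.
Proof. by case: dP. Qed.

Lemma metric_triangle y x z : d x z <= d x y + d y z.
Proof. by case: dP. Qed.

Lemma metric_ge0 x y : 0 <= d x y.
Proof. by case: dP. Qed.

Lemma metric_eq0 x y : d x y = 0 -> x = y.
Proof. by case: dP => _ d0 _ _ _ /d0. Qed.

Lemma nbhs_metric x e : 0 < e -> nbhs x [set y | d x y < e].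
Proof. by case: dP => _ _ _ _ h e0; apply/h; exists e. Qed.

Lemma nbhs_metricP x (A : set N) :
  nbhs x A <-> exists2 e : R, 0 < e & [set y | d x y < e] `<=` A.
Proof. by case: dP. Qed.

Lemma metric_hausdorff : hausdorff_space N.
Proof.
move=> x y xy; apply: metric_eq0; apply/eqP; rewrite eq_le metric_ge0 andbT.
rewrite leNgt; apply/negP => d0.
have e0 : 0 < d x y / 2 by rewrite divr_gt0.
have [z /= [xz yz]] := xy _ _ (nbhs_metric x _ e0) (nbhs_metric y _ e0).
by have := metric_triangle z x y; rewrite (metric_sym z); lra.
Qed.

End Metric.

Inductive rtc {N : Type} (S : N -> N -> Prop) (x : N) : N -> Prop :=
| rtc_refl : rtc S x x
| rtc_rcons y z : rtc S x y -> S y z -> rtc S x z.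

Lemma rtc_trans {N : Type} {S : N -> N -> Prop} y x z :
  rtc S x y -> rtc S y z -> rtc S x z.
Proof. by move=> xy; elim=> // a b _ xa ab; apply: rtc_rcons ab. Qed.

Lemma rtc1 {N : Type} {S : N -> N -> Prop} x y : S x y -> rtc S x y.
Proof. by move=> xy; apply: rtc_rcons xy; exact: rtc_refl. Qed.

Lemma rtc_map {N N' : Type} {S : N -> N -> Prop} {S' : N' -> N' -> Prop} (f : N -> N') :
  (forall x y, S x y -> S' (f x) (f y)) -> forall x y, rtc S x y -> rtc S' (f x) (f y).
Proof.
move=> h x y; elim=> [|a b _ xa ab]; first exact: rtc_refl.
by apply: rtc_rcons xa _; exact: h.
Qed.

Section Chains.
Context {R : realType} {N : topologicalType}.
Variables (psi : R -> N -> N) (d : N -> N -> R) (T : R).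

(** A flow segment and the jump that closes it. A chain ends right after a jump; the segment after
    the last jump of a pseudo-orbit has no lower bound on its length and is carried separately as a
    time [tau]. *)
Definition step (eps : R) (x y : N) := exists2 tau, T <= tau & d (psi tau x) y < eps.

Definition chain eps := rtc (step eps).

Lemma step_le eps eps' x y : eps <= eps' -> step eps x y -> step eps' x y.
Proof. by move=> le [tau Ttau xy]; exists tau => //; exact: lt_le_trans le. Qed.

Lemma chain_le eps eps' x y : eps <= eps' -> chain eps x y -> chain eps' x y.
Proof. by move=> le; apply: (rtc_map id) => a b; exact: step_le. Qed.

Hypothesis T_gt0 : 0 < T.
Hypothesis dP : compatible_metric d.
Hypothesis psiP : is_flow psi.

Lemma flow0 x : psi 0 x = x.
Proof. by case: psiP. Qed.

Lemma flowD s t x : psi (s + t) x = psi s (psi t x).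
Proof. by case: psiP. Qed.

Lemma flow_continuous2 : continuous (fun z : R * N => psi z.1 z.2).
Proof. by case: psiP. Qed.

Lemma flow_continuous_time x : continuous (fun t => psi t x).
Proof.
move=> t; apply: (@continuous_comp _ _ _ (fun t => (t, x)) (fun z => psi z.1 z.2)).
  exact: (cvg_pair cvg_id (cvg_cst x)).
exact: flow_continuous2.
Qed.

(** Cutting at [D] gives steps, as the points of [D] are at least [T] away from [0] and from each
    other. [tau] is the time since the last jump; it is positive at the end, which is a left
    limit. *)
Lemma pseudo_orbit_chain eps l gam : pseudo_orbit psi d T eps l gam ->
  (forall t, 0 <= t < l -> exists y tau,
     [/\ chain eps (gam 0) y, 0 <= tau & gam t = psi tau y]) /\
  (forall z, gam t @[t --> l^'-] --> z -> exists y tau,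
     [/\ chain eps (gam 0) y, 0 < tau & z = psi tau y]).
Proof.
have T0 := T_gt0; move=> [l0 gamr gamf [D [_ DT Dsep gamc gamj]]].
have flowP u s : 0 <= u <= s -> s < l -> (forall w, u < w <= s -> ~ D w) ->
    gam s = psi (s - u) (gam u).
  move=> /andP[u0 us] sl noD; apply: gamf => //; first by rewrite u0.
  apply/subspace_continuousP => x /=; rewrite in_itv /= => /andP[ux xs].
  move: ux; rewrite le_eqVlt => /predU1P[<-|ux] A nA.
    have : 0 <= u < l by rewrite u0 (le_lt_trans us).
    move=> /gamr /(_ A nA) /=; rewrite !nbhs_simpl /at_right /within /=.
    apply: filterS => w /= wA; rewrite in_itv /= => /andP[uw _].
    move: uw; rewrite le_eqVlt => /predU1P[<-|]; last exact: wA.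
    exact: nbhs_singleton.
  have xl : 0 <= x < l by rewrite (le_lt_trans xs) // andbT ltW // (le_lt_trans u0).
  have Dx : ~ D x by apply: noD; rewrite ux.
  have := gamc _ xl Dx A nA; rewrite !nbhs_simpl /within /=.
  apply: filterS => w /= wA; rewrite in_itv /= => /andP[uw ws]; apply: wA.
  by rewrite in_itv /= (le_trans u0 uw) (le_lt_trans ws).
have limP u v z : 0 <= u < v -> v <= l -> (forall w, u < w < v -> ~ D w) ->
    gam x @[x --> v^'-] --> z -> z = psi (v - u) (gam u).
  move=> /andP[u0 uv] vl noD gz.
  apply: (cvg_unique (metric_hausdorff dP) gz).
  have : psi (s - u) (gam u) @[s --> v^'-] --> psi (v - u) (gam u).
    apply: cvg_at_left_filter.
    apply: (@continuous_comp _ _ _ (fun s => s - u) (fun t => psi t (gam u))).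
      by apply: cvgB; [exact: cvg_id|exact: cvg_cst].
    exact: flow_continuous_time.
  apply: cvg_trans; apply: near_eq_cvg; near=> s.
  have sv : s < v by near: s; exact: nbhs_left_lt.
  have us : u < s by near: s; exact: nbhs_left_gt.
  apply/esym/flowP; [by rewrite u0 ltW|exact: lt_le_trans vl|].
  by move=> w /andP[uw ws]; apply: noD; rewrite uw (le_lt_trans ws).
have DT' v : D v -> T <= v < l by move=> /DT /=; rewrite in_itv.
(* [u] is the last point of [D] up to [t], or [0]. The window [(t - T, t]] holds at most one point
   of [D], so induction over windows of length [T] reaches it. *)
have last_jump n t : 0 <= t < l -> t < T *+ n -> exists u,
    [/\ 0 <= u <= t, chain eps (gam 0) (gam u), u = 0 \/ D u &
        forall w, u < w <= t -> ~ D w].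
  elim: n t => [|n IH] t /andP[t0 tl] tn; first by move: tn; rewrite mulr0n; lra.
  move: tn; rewrite mulrS => tn.
  have [[v [vt Dv]]|noD] := pselect (exists v, t - T < v <= t /\ D v).
    have vT := DT' _ Dv.
    have [||u [u0 cu uD noD]] := IH (v - T); [lra|lra|].
    have u0v : 0 <= u < v by lra.
    have {}noD w : u < w < v -> ~ D w.
      move=> uwv Dw; have [wv|wv] := leP w (v - T); first by apply: (noD w) => //; lra.
      have wnv : w <> v by move=> wv'; move: uwv; rewrite wv' ltxx andbF.
      by have := Dsep _ _ Dw Dv wnv; rewrite ltr0_norm; lra.
    exists v; split; [by lra| |by right|].
      apply: rtc_rcons cu _; have [z gz dz] := gamj _ Dv.
      exists (v - u); last first.
        by rewrite -(limP _ _ _ u0v _ noD gz) 1?(metric_sym dP) //; lra.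
      case: uD => [->|Du]; first by lra.
      have unv : v <> u by move=> uv; move: u0v; rewrite uv ltxx andbF.
      by have := Dsep _ _ Dv Du unv; rewrite gtr0_norm; lra.
    move=> w vwt Dw; have wnv : w <> v by move=> wE; move: vwt; rewrite wE; lra.
    by have := Dsep _ _ Dw Dv wnv; rewrite gtr0_norm; lra.
  have {}noD w : t - T < w <= t -> ~ D w by move=> tw Dw; apply: noD; exists w.
  have [tT|tT] := ltP t T.
    exists 0; split; [by lra|exact: rtc_refl|by left|].
    by move=> w w0 /DT'; lra.
  have [||u [u0 cu uD noD']] := IH (t - T); [lra|lra|].
  exists u; split => //; first by lra.
  move=> w uwt Dw; have [wv|wv] := leP w (t - T).
    by apply: (noD' w) => //; lra.
  by apply: (noD w) => //; lra.
have {}last_jump t : 0 <= t < l -> exists u,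
    [/\ 0 <= u <= t, chain eps (gam 0) (gam u), u = 0 \/ D u &
        forall w, u < w <= t -> ~ D w].
  move=> tl; apply: (last_jump (Num.bound (t / T))) => //.
  rewrite -mulr_natr -ltr_pdivrMl // mulrC.
  by apply: archi_boundP; apply: divr_ge0; lra.
split=> [t tl|z gz].
  have [u [u0 cu _ noD]] := last_jump _ tl.
  by exists (gam u), (t - u); split => //; [lra|apply: flowP => //; lra].
suff [u [u0 cu noD]] : exists u, [/\ 0 <= u < l, chain eps (gam 0) (gam u) &
    forall w, u < w < l -> ~ D w].
  exists (gam u), (l - u); split => //; first by lra.
  exact: limP gz.
have [[v [vt Dv]]|noD] := pselect (exists v, l - T < v < l /\ D v).
  have vT := DT' _ Dv; have [|u [u0 cu _ noD]] := last_jump v; first by lra.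
  have uv : u = v.
    have /andP[_] := u0; rewrite le_eqVlt => /predU1P[//|uv].
    by exfalso; apply: (noD v) => //; rewrite uv lexx.
  exists v; split; [by lra|by rewrite -uv|].
  move=> w vwt Dw; have wnv : w <> v by move=> wE; move: vwt; rewrite wE; lra.
  by have := Dsep _ _ Dw Dv wnv; rewrite gtr0_norm; lra.
have {}noD w : l - T < w < l -> ~ D w by move=> tw Dw; apply: noD; exists w.
have [lT|lT] := leP l T.
  exists 0; split; [by lra|exact: rtc_refl|].
  by move=> w w0 /DT'; lra.
have [|u [u0 cu uD noD']] := last_jump (l - T); first by lra.
exists u; split => //; first by lra.
move=> w uwt Dw; have [wv|wv] := leP w (l - T).
  by apply: (noD' w) => //; lra.
by apply: (noD w) => //; lra.
Unshelve. all: end_near. Qed.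

(* [D] is kept to the genuine discontinuities ([z <> gam u]), so that a
   continuous stretch of [gam] contains no point of [D]. *)
Lemma chain_path eps x y : chain eps x y -> exists t0 gam (D : set R),
  [/\ 0 <= t0 /\ gam 0 = x, forall s, t0 <= s -> gam s = psi (s - t0) y,
      forall t s, 0 <= t <= s -> (forall w, t < w <= s -> ~ D w) ->
        gam s = psi (s - t) (gam t),
      finite_set D /\ (forall u, D u -> T <= u <= t0) &
      (forall u v, D u -> D v -> u <> v -> T <= `|u - v|) /\
      forall u, D u -> exists w z, [/\ 0 <= w < u, z <> gam u, d z (gam u) < eps,
         z = psi (u - w) (gam w) & forall s, w <= s < u -> gam s = psi (s - w) (gam w)]].
Proof.
have T0 := T_gt0.
elim=> [|a b _ [t0 [gam [D [[t00 gam0] gamt gamf [Dfin DT] [Dsep Dj]]]]] [tau Ttau ab]].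
  exists 0, (psi^~ x), set0; split => //.
  - by rewrite flow0.
  - by move=> s _; rewrite subr0.
  - by move=> t s _ _; rewrite -flowD subrK.
have [t1 t1E] : exists t1, t1 = t0 + tau by exists (t0 + tau).
have [gam' [g'l g'r]] : exists gam' : R -> N,
    (forall s, s < t1 -> gam' s = gam s) /\
    (forall s, t1 <= s -> gam' s = psi (s - t1) b).
  exists (fun s => if s < t1 then gam s else psi (s - t1) b).
  by split=> [s ->//|s]; rewrite leNgt => /negbTE ->.
pose D' := D `|` [set u | u = t1 /\ psi tau a <> b].
have D't u : D' u -> T <= u <= t1 by move=> [/DT|[-> _]]; lra.
exists t1, gam', D'; split => //.
- by split; [lra|rewrite g'l //; lra].
- move=> t s ts noD; have [st|st] := ltP s t1.
    rewrite !g'l //; last by lra.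
    by apply: gamf => // w /noD nD Dw; apply: nD; left.
  have [tt|tt] := ltP t t1; last by rewrite !g'r // -flowD; congr psi; lra.
  have tauab : psi tau a = b.
    apply: contrapT => nab; apply: (noD t1); first by rewrite tt st.
    by right.
  have -> : gam' s = psi (s - t0) a.
    by rewrite g'r // -tauab -flowD; congr psi; lra.
  rewrite g'l //; have [t0t|tt0] := leP t0 t.
    by rewrite gamt // -flowD; congr psi; lra.
  have -> : a = gam t0 by rewrite gamt // subrr flow0.
  rewrite [gam t0](gamf t t0); [|by lra|].
    by rewrite -flowD; congr psi; lra.
  by move=> w wt Dw; apply: (noD w); [lra|left].
- split; last exact: D't.
  rewrite finite_setU; split => //.
  by apply: (@sub_finite_set _ _ [set t1]) => // u [].
split=> [u v [Du|[-> _]] [Dv|[-> _]] uv|u [Du|[-> ab']]].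
- exact: Dsep.
- by have uT := DT _ Du; rewrite ler0_norm; lra.
- by have vT := DT _ Dv; rewrite ger0_norm; lra.
- by [].
- have [w [z [w0 zu dz zw gw]]] := Dj _ Du; have uT := DT _ Du.
  have ut : u < t1 by lra.
  exists w, z; rewrite !g'l //; last by lra.
  by split => // s sw; rewrite g'l; [exact: gw|lra].
- exists t0, (psi tau a).
  have -> : gam' t0 = a by rewrite g'l ?gamt ?subrr ?flow0 //; lra.
  have -> : gam' t1 = b by rewrite g'r // subrr flow0.
  split => //; first by lra.
    by congr psi; lra.
  by move=> s st; rewrite g'l ?gamt //; lra.
Qed.

(** The path of [chain_path] is prolonged by flowing for time [tau], positive so that no jump occurs
    at the end [l = t0 + tau] and the left limit there is the flowed point. *)
Lemma chain_pseudo_orbit eps x y tau : chain eps x y -> 0 < tau ->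
  exists l gam, [/\ pseudo_orbit psi d T eps l gam, gam 0 = x,
    gam t @[t --> l^'-] --> psi tau y & exists2 t, 0 <= t < l & gam t = y].
Proof.
have T0 := T_gt0.
move=> /chain_path[t0 [gam [D [[t00 gam0] gamt gamf [Dfin DT] [Dsep Dj]]]]] tau0.
have psic s u : psi (x - u) (gam u) @[x --> s] --> psi (s - u) (gam u).
  apply: (@continuous_comp _ _ _ (fun s => s - u) (fun t => psi t (gam u))).
    by apply: cvgB; [exact: cvg_id|exact: cvg_cst].
  exact: flow_continuous_time.
have nextD t : exists2 t', t < t' & forall w, t < w <= t' -> ~ D w.
  have : closed (D `\ t).
    apply: compact_closed => //; apply: finite_compact.
    exact: finite_setD.
  rewrite -openC => oD.
  have : nbhs t (~` (D `\ t)) by apply: open_nbhs_nbhs; split => //= -[].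
  move=> /nbhs_ballP [e /= e0 eD]; exists (t + e / 2); first by lra.
  move=> w tw Dw; apply: (eD w); last by split => // wt; move: tw; rewrite /= wt; lra.
  by rewrite /ball /= ltr0_norm; lra.
have prevD t : exists2 t', t' < t & forall w, t' <= w < t -> ~ D w.
  have : closed (D `\ t).
    apply: compact_closed => //; apply: finite_compact.
    exact: finite_setD.
  rewrite -openC => oD.
  have : nbhs t (~` (D `\ t)) by apply: open_nbhs_nbhs; split => //= -[].
  move=> /nbhs_ballP [e /= e0 eD]; exists (t - e / 2); first by lra.
  move=> w tw Dw; apply: (eD w); last by split => // wt; move: tw; rewrite /= wt; lra.
  by rewrite /ball /= gtr0_norm; lra.
have gamr t : 0 <= t -> gam s @[s --> t^'+] --> gam t.
  move=> t0'; have [t' tt' noD] := nextD t.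
  have := psic t t; rewrite subrr flow0 => /cvg_at_right_filter.
  apply: cvg_trans; apply: near_eq_cvg; near=> s.
  have ts : t < s by near: s; exact: nbhs_right_gt.
  have st' : s < t' by near: s; exact: nbhs_right_lt.
  by apply/esym/gamf => [|w w1]; [lra|apply: noD; lra].
have gaml t : 0 < t -> ~ D t -> gam s @[s --> t^'-] --> gam t.
  move=> t0' Dt; have [t' tt' noD] := prevD t.
  pose u := Num.max 0 t'.
  have u0 : 0 <= u by rewrite le_max lexx.
  have ut : u < t by rewrite gt_max t0'.
  have t'u : t' <= u by rewrite le_max lexx orbT.
  have -> : gam t = psi (t - u) (gam u).
    apply: gamf => [|w w1]; first by lra.
    by have [->//|wt] := eqVneq w t; apply: noD; move: w1;
        rewrite le_eqVlt (negbTE wt) /=; lra.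
  have := psic t u => /cvg_at_left_filter.
  apply: cvg_trans; apply: near_eq_cvg; near=> s.
  have us : u < s by near: s; exact: nbhs_left_gt.
  have st : s < t by near: s; exact: nbhs_left_lt.
  by apply/esym/gamf => [|w w1]; [lra|apply: noD; lra].
exists (t0 + tau), gam; split => //; last first.
- by exists t0; [lra|rewrite gamt // subrr flow0].
- have -> : psi tau y = gam (t0 + tau) by rewrite gamt; [congr psi; lra|lra].
  by apply: gaml; [lra|move=> /DT; lra].
split=> [|t tl|s t ts tl gc|].
- by lra.
- by apply: gamr; lra.
(* At a jump time [w] in [(t, s]], continuity would identify [gam w] with the left limit [z],
   although [D] contains only genuine jumps. *)
- apply: gamf => // w tw Dw.
  have [v [z [v0 zw dz zE gv]]] := Dj _ Dw; apply: zw.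
  have gz : gam x @[x --> w^'-] --> z.
    rewrite zE; have := psic w v => /cvg_at_left_filter.
    apply: cvg_trans; apply: near_eq_cvg; near=> u.
    apply/esym/gv; apply/andP; split; last by near: u; exact: nbhs_left_lt.
    by near: u; apply: nbhs_left_ge; lra.
  apply: (cvg_unique (metric_hausdorff dP) gz).
  move/subspace_continuousP : gc => /(_ w); rewrite /= in_itv /= => gc.
  have {}gc := gc ltac:(lra).
  have tu : \forall u \near w, t < u by apply: lt_nbhsr; lra.
  apply: cvg_trans gc => A /=; rewrite !nbhs_simpl /within /= => gA.
  rewrite /at_left /within /=; near=> u => uw.
  have tu' : t < u by near: u.
  have uA : u \in `[t, s] -> A (gam u) by near: u.
  by apply: uA; rewrite in_itv /=; lra.
exists D; split => //.
- by move=> u /DT uT /=; rewrite in_itv /=; lra.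
- move=> t /andP[t0' tl] Dt A nA /=; rewrite nbhs_simpl /within /=.
  have rA : \forall u \near t, t < u -> A (gam u) by exact: (gamr t t0' A nA).
  have lA : \forall x \near t, 0 <= x < t -> A (gam x).
    move: t0'; rewrite le_eqVlt => /predU1P[<-|t0'']; first by near=> u; lra.
    have := gaml t t0'' Dt A nA; rewrite /= nbhs_simpl /at_left /within /=.
    by move=> h; near=> u => /andP[_]; near: u.
  suff h : \forall u \near t, 0 <= u < t0 + tau -> A (gam u).
    by apply: filterS h => u uA; rewrite /= in_itv; exact: uA.
  near=> u => /andP[u0 ul].
  have [ut|tu|->] := ltgtP u t.
  + have uA : 0 <= u < t -> A (gam u) by near: u.
    by apply: uA; rewrite u0.
  + by move: tu; near: u.
  + exact: nbhs_singleton nA.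
- move=> u Du; have [w [z [w0 zu dz zE gw]]] := Dj _ Du; exists z;
    last by rewrite (metric_sym dP).
  rewrite zE; have := psic u w => /cvg_at_left_filter.
  apply: cvg_trans; apply: near_eq_cvg; near=> v.
  apply/esym/gw; apply/andP; split; last by near: v; exact: nbhs_left_lt.
  by near: v; apply: nbhs_left_ge; lra.
Unshelve. all: end_near. Qed.

End Chains.

(** * Cocompact group actions *)

Lemma segment_near {R : realType} (a b : R) (P : R -> R -> Prop) :
  (forall t, a <= t <= b -> exists2 e, 0 < e &
     forall t' h, `|t - t'| < e -> 0 < h < e -> P h t') ->
  exists2 e, 0 < e & forall h, 0 < h < e -> forall t, a <= t <= b -> P h t.
Proof.
move=> loc; have /compact_near_coveringP := @segment_compact R a b.
move=> /(_ R (0 : R)^'+ P _) [t /=|e /= e0 eP].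
  rewrite in_itv /= => /loc[e e0 eP].
  exists (ball t e, [set h | 0 < h < e]); last by move=> [t' h] /= [? ?]; exact: eP.
  split; first exact: nbhsx_ballx.
  near=> h; rewrite /=; apply/andP; split; near: h; first exact: nbhs_right_gt.
  exact: nbhs_right_lt.
exists e => // h h0e t tab; apply: (eP h) => /=; last by rewrite in_itv.
- by rewrite sub0r normrN gtr0_norm; case/andP: h0e.
- by case/andP: h0e.
Unshelve. all: end_near. Qed.

(** The filter of sequences containing a given finite set. Compactness stated with filters, applied
    to it, selects finitely many points or labels. *)
Definition supseq {A : eqType} : set_system (seq A) :=
  fun B => exists s0 : seq A, forall s : seq A, (forall x, x \in s0 -> x \in s) -> B s.

Global Instance supseq_filter (A : eqType) : Filter (@supseq A).
Proof.
split; first by exists [::].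
- move=> P Q [s1 h1] [s2 h2]; exists (s1 ++ s2) => s sub; split.
    by apply: h1 => x xs; apply: sub; rewrite mem_cat xs.
  by apply: h2 => x xs; apply: sub; rewrite mem_cat xs orbT.
- by move=> P Q PQ [s0 h]; exists s0 => s /h; exact: PQ.
Qed.

Lemma near_supseq {A : eqType} (a : A) : supseq (fun s : seq A => a \in s).
Proof. by exists [:: a] => s; apply; rewrite mem_head. Qed.

Lemma supseq_ex {A : eqType} (P : set (seq A)) : supseq P -> exists s, P s.
Proof. by move=> [s h]; exists s; exact: h. Qed.

(* [cs_near] is compactness of the quotient of [X] by [H], in the form used for
   uniformity arguments: an [H]-invariant property that holds locally holds
   globally. *)
Record cocompact_system {R : realType} {X : topologicalType} {H : zmodType}
    (act : H -> X -> X) (psi : R -> X -> X) (d : X -> X -> R) (T : R) : Prop := {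
  cs_T : 0 < T;
  cs_metric : compatible_metric d;
  cs_flow : is_flow psi;
  cs_act0 : forall x, act 0 x = x;
  cs_actD : forall a b x, act (a + b) x = act a (act b x);
  cs_isom : forall a x y, d (act a x) (act a y) = d x y;
  cs_free : exists2 r, 0 < r & forall a x, d x (act a x) < r -> a = 0;
  cs_comm : forall t a x, psi t (act a x) = act a (psi t x);
  cs_near : forall (I : Type) (F : set_system I) (P : I -> X -> Prop), Filter F ->
    (forall a i x, P i x -> P i (act a x)) ->
    (forall x : X, \forall x' \near x & i \near F, P i x') ->
    \forall i \near F, forall x, P i x }.

Section Uniformity.
Context {R : realType} {X : topologicalType} {H : zmodType}.
Context {act : H -> X -> X} {psi : R -> X -> X} {d : X -> X -> R} {T : R}.
Hypothesis cs : cocompact_system act psi d T.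

Let T_gt0 := cs_T _ _ _ _ cs.
Let dP := cs_metric _ _ _ _ cs.
Let psiP := cs_flow _ _ _ _ cs.
Let act0 := cs_act0 _ _ _ _ cs.
Let actD := cs_actD _ _ _ _ cs.
Let isom := cs_isom _ _ _ _ cs.
Let comm := cs_comm _ _ _ _ cs.

Lemma actK a : cancel (act a) (act (- a)).
Proof. by move=> x; rewrite -actD addNr act0. Qed.

Lemma actNK a : cancel (act (- a)) (act a).
Proof. by move=> x; rewrite -actD subrr act0. Qed.

Lemma isomK a x y : d (act a x) y = d x (act (- a) y).
Proof. by rewrite -{1}[y](actNK a) isom. Qed.

Lemma act_inj x a b : act a x = act b x -> a = b.
Proof.
case: (cs_free _ _ _ _ cs) => r r0 free ab.
apply/eqP; rewrite -subr_eq0; apply/eqP; apply: (free _ x).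
by rewrite addrC actD ab actK (metric_refl dP).
Qed.

Lemma cocompact_eps (P : R -> X -> Prop) :
  (forall a h x, P h x -> P h (act a x)) ->
  (forall x, exists2 e, 0 < e & forall x' h, d x x' < e -> 0 < h < e -> P h x') ->
  exists2 h, 0 < h & forall x, P h x.
Proof.
move=> Pact loc; have := @cs_near _ _ _ _ _ _ _ cs R (0 : R)^'+ P _ Pact.
case=> [x|e /= e0 eP].
  have [e e0 eP] := loc x.
  exists ([set y | d x y < e], [set h | 0 < h < e]).
    split; first exact: nbhs_metric.
    near=> h; rewrite /=; apply/andP; split; near: h; first exact: nbhs_right_gt.
    exact: nbhs_right_lt.
  by move=> [y h] /= [? ?]; exact: eP.
exists (e / 2) => [|x]; first by rewrite divr_gt0.
by apply: eP; rewrite /= ?divr_gt0 // sub0r normrN gtr0_norm; lra.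
Unshelve. all: end_near. Qed.

Lemma flow_uniform (L e : R) : 0 < e -> exists2 h, 0 < h &
  forall x y t, `|t| <= L -> d x y < h -> d (psi t x) (psi t y) < e.
Proof.
move=> e0; apply: (cocompact_eps (fun h x => forall y t, `|t| <= L -> d x y < h ->
   d (psi t x) (psi t y) < e)).
  by move=> a h x hP y t tL; rewrite isomK => xy; rewrite comm isomK -comm; exact: hP.
move=> x; have [|h h0 hP] := @segment_near _ (- L) L (fun h t => forall y z,
    d x y < h -> d y z < h -> d (psi t y) (psi t z) < e).
  move=> t _; have e2 : 0 < e / 2 by rewrite divr_gt0.
  have [[/= A B] [nA /(nbhs_metricP dP)[r r0 rB]] AB] :=
    flow_continuous2 psi psiP (t, x) _ (nbhs_metric dP (psi t x) _ e2).
  move/nbhs_ballP : nA => [q /= q0 qA].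
  exists (Num.min q (r / 2)); first by rewrite lt_min q0 divr_gt0.
  move=> t' h; rewrite !lt_min => /andP[tq tr] /and3P[h0 hq hr] y z xy yz.
  have xz := metric_triangle dP y x z.
  have yA : d (psi t x) (psi t' y) < e / 2.
    by apply: (AB (t', y)); split => /=; [exact: qA|apply: rB => /=; lra].
  have zA : d (psi t x) (psi t' z) < e / 2.
    by apply: (AB (t', z)); split => /=; [exact: qA|apply: rB => /=; lra].
  have := metric_triangle dP (psi t x) (psi t' y) (psi t' z).
  by rewrite (metric_sym dP (psi t' y) (psi t x)); lra.
exists h => // y k xy /andP[k0 kh] z t; rewrite ler_norml => tL yz.
(* A radius strictly between [Num.max k (d x y)] and [h], since [hP] asks for strict inequalities on
   both distances. *)
apply: (hP ((Num.max k (d x y) + h) / 2)) => //.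
- have : Num.max k (d x y) < h by rewrite gt_max kh.
  have : 0 < Num.max k (d x y) by rewrite lt_max k0.
  by lra.
- have : Num.max k (d x y) < h by rewrite gt_max kh.
  have : d x y <= Num.max k (d x y) by rewrite le_max lexx orbT.
  by lra.
- have : Num.max k (d x y) < h by rewrite gt_max kh.
  have : k <= Num.max k (d x y) by rewrite le_max lexx.
  by lra.
Qed.

Lemma finite_net (e : R) : 0 < e -> exists (n : nat) (p : 'I_n -> X),
  forall x, exists i a, d x (act a (p i)) < e.
Proof.
move=> e0; have [||s sP] := supseq_ex _ (@cs_near _ _ _ _ _ _ _ cs (seq X) supseq
    (fun (s : seq X) x => exists2 p, p \in s & exists a, d x (act a p) < e) _ _ _).
- by move=> a s x [p ps [b xp]]; exists p => //; exists (a + b); rewrite actD isom.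
- move=> x; exists ([set y | d x y < e], (fun s : seq X => is_true (x \in s))).
    by split; [exact: nbhs_metric|exact: near_supseq].
  by move=> [y s] /= [xy xs]; exists x => //; exists 0; rewrite act0 (metric_sym dP).
exists (size s), (fun i => tnth (in_tuple s) i) => x.
have [p /(nthP p)[i i_s <-] [a xp]] := sP x.
by exists (Ordinal i_s), a; rewrite (tnth_nth p).
Qed.

(** Although [f] is not invariant, [f x - f y] is unchanged when [act a] moves both points, so
    continuity becomes uniform by cocompactness. *)
Lemma equivariant_uniform (al : H -> R) (f : X -> R) : continuous f ->
  (forall a x, f (act a x) = f x + al a) ->
  exists2 e, 0 < e & forall x y, d x y < e -> `|f x - f y| <= 1.
Proof.
move=> fc fE; apply: (cocompact_eps (fun h x => forall y, d x y < h -> `|f x - f y| <= 1)).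
  move=> a h x hP y; rewrite isomK => /hP; rewrite -{2}[y](actNK a) !(fE a).
  by rewrite opprD addrACA subrr addr0.
move=> x; have h2 : (0 : R) < 1 / 2 by lra.
have := fc x _ (nbhsx_ballx (f x) _ h2).
move=> /(nbhs_metricP dP)[e e0 eP]; exists (e / 2); first by lra.
move=> y h xy /andP[h0 hq] z yz; have xz := metric_triangle dP y x z.
have := eP y ltac:(rewrite /=; lra); have := eP z ltac:(rewrite /=; lra).
rewrite /ball /= => fxz fxy; have := ler_normD (f y - f x) (f x - f z).
by rewrite addrA subrK (distrC (f y) (f x)); lra.
Qed.

Lemma equivariant_drift (al : H -> R) (f : X -> R) (L : R) : continuous f ->
  (forall a x, f (act a x) = f x + al a) ->
  exists K, forall x t, `|t| <= L -> `|f (psi t x) - f x| <= K.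
Proof.
move=> fc fE; have [e e0 eP] := equivariant_uniform al f fc fE.
have [h h0 hP] := flow_uniform L e e0.
(* Seeking the bound in the form [h^-1] turns local boundedness into a property of all small [h]. *)
have [||k k0 kP] := cocompact_eps (fun h x => forall t, `|t| <= L ->
    `|f (psi t x) - f x| <= h^-1).
- move=> a k x kP t tL; rewrite comm !fE.
  by rewrite opprD addrACA subrr addr0; exact: kP.
(* The [2] pays for replacing [x] by [y] and [psi t x] by [psi t y], each at a cost of at most
   [1]. *)
- move=> x; have [|q q0 qP] := @segment_near _ (- L) L (fun k t => `|f
    (psi t x) - f x| + 2 <= k^-1).
    move=> t _.
    have c : (fun t => f (psi t x)) s @[s --> t] --> f (psi t x).
      apply: (@continuous_comp _ _ _ (psi^~ x) f); first exact: flow_continuous_time.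
      exact: fc.
    have := c _ (nbhsx_ballx (f (psi t x)) _ ltr01) => /nbhs_ballP[q /= q0 qP].
    pose m := `|f (psi t x) - f x| + 3.
    have m0 : 0 < m by rewrite ltr_wpDl.
    exists (Num.min q m^-1); first by rewrite lt_min q0 invr_gt0.
    move=> t' k; rewrite !lt_min => /andP[tq _] /and3P[k0' _ km].
    have := qP t' tq; rewrite /ball /= => ft.
    have km' : m < k^-1 by rewrite -[m]invrK ltf_pV2 // posrE invr_gt0.
    have := ler_normD (f (psi t' x) - f (psi t x)) (f (psi t x) - f x).
    by rewrite addrA subrK (distrC (f (psi t' x)) (f (psi t x))); rewrite /m in km'; lra.
  exists (Num.min q (Num.min h e)); first by rewrite !lt_min q0 h0.
  move=> y k; rewrite !lt_min => /and3P[xq xh xe] /and4P[k0 kq _ _] t tL.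
  have := qP k ltac:(lra) t; rewrite ler_norml in tL => /(_ tL) fx.
  rewrite -ler_norml in tL.
  have f1 := eP _ _ (hP _ _ _ tL xh).
  have f2 := eP _ _ xe.
  have := ler_normD (f (psi t y) - f (psi t x)) (f (psi t x) - f x).
  have := ler_normD (f (psi t y) - f x) (f x - f y).
  by rewrite !addrA !subrK (distrC (f (psi t y)) (f (psi t x))); lra.
by exists k^-1 => x t; exact: kP.
Qed.

End Uniformity.

(** * Finite graphs and chains *)

Section Walks.
Context {R : realType} {H : zmodType} {I : finType}.
Variable E : I -> H -> I -> Prop.

Inductive walk : nat -> I -> H -> I -> Prop :=
| walk0 i : walk 0 i 0 i
| walkS n i a j b k : walk n i a j -> E j b k -> walk n.+1 i (a + b) k.

Lemma walk_cat m i a j n b k : walk m i a j -> walk n j b k -> walk (m + n) i (a + b) k.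
Proof.
move=> ij jk; elim: jk ij => [j' ij|n' j' b' l c k' _ IH lk ij];
    first by rewrite addn0 addr0.
by rewrite addnS addrA; apply: walkS lk; exact: IH.
Qed.

Lemma walk_positions n i a j : walk n i a j -> exists (v : nat -> I) (A : nat -> H),
  [/\ v 0%N = i, A 0%N = 0, v n = j, A n = a &
      forall k, (k < n)%N -> E (v k) (A k.+1 - A k) (v k.+1)].
Proof.
elim=> [i'|n' i' a' j' b k _ [v [A [v0 A0 vn An vE]]] jk];
    first by exists (fun=> i'), (fun=> 0).
exists (fun l => if (l <= n')%N then v l else k), (fun l => if
    (l <= n')%N then A l else a' + b).
split; rewrite ?ltnn // => l; rewrite ltnS => ln; rewrite ln.
have [ln'|n'l] := ltnP l n'; first exact: vE.
have -> : l = n' by apply/eqP; rewrite eqn_leq ln.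
by rewrite vn An addrAC subrr add0r.
Qed.

Lemma positions_walk (v : nat -> I) (A : nat -> H) p m :
  (forall k, (p <= k < p + m)%N -> E (v k) (A k.+1 - A k) (v k.+1)) ->
  walk m (v p) (A (p + m)%N - A p) (v (p + m)%N).
Proof.
elim: m => [|m IH] vE; first by rewrite addn0 subrr; exact: walk0.
have -> : A (p + m.+1)%N - A p = (A (p + m)%N - A p) + (A (p + m).+1 - A (p + m)%N).
  by rewrite [RHS]addrC addrA subrK addnS.
rewrite addnS; apply: walkS (vE _ _); last by rewrite leq_addr addnS ltnS /=.
by apply: IH => k /andP[pk km]; apply: vE; rewrite pk addnS ltnS ltnW.
Qed.

(* Removing from a long walk the closed subwalk between two visits of the same
   vertex does not decrease [chi]. *)
Lemma walk_reduce (chi : H -> R) : {morph chi : a b / a + b} ->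
  (forall n i a, (n <= #|I|)%N -> walk n i a i -> chi a <= 0) ->
  forall n i a j, walk n i a j ->
    exists m b, [/\ (m <= #|I|)%N, walk m i b j & chi a <= chi b].
Proof.
move=> chiD cyc n; have [k nk] := ubnP n; elim: k n nk => // k IH n;
    rewrite ltnS => nk i a j ij.
have [nI|In] := leqP n #|I|; first by exists n, a.
have [v [A [v0 A0 vn An vE]]] := walk_positions _ _ _ _ ij.
(* Pigeonhole among the first [#|I| + 1] positions only: the closed subwalk then has at most [#|I|]
   edges and [cyc] applies to it. *)
have : ~~ injectiveb (fun p : 'I_(#|I|.+1) => v p).
  by apply/injectiveP => /leq_card; rewrite card_ord ltnn.
move=> /injectivePn[p0 [q0 pq vpq]].
wlog lt_pq : p0 q0 pq vpq / (p0 < q0)%N.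
  move=> th; have [pq'|qp'|pq'] := ltngtP p0 q0; first exact: (th p0 q0).
    by apply: (th q0 p0) => //; rewrite eq_sym.
  by move: pq; rewrite -(inj_eq val_inj) /= pq' eqxx.
move: p0 q0 {pq} vpq lt_pq => [p pI] [q qI] /= vpq lt_pq.
have qn : (q <= n)%N by rewrite ltnS in qI; apply: leq_trans qI (ltnW In).
have wcyc : walk (q - p) (v p) (A q - A p) (v p).
  have := positions_walk v A p (q - p) _; rewrite subnKC ?(ltnW lt_pq) // -vpq; apply.
  by move=> l /andP[_ lq]; apply: vE; apply: leq_trans lq qn.
have w1 : walk p i (A p) (v p).
  have := positions_walk v A 0 p _; rewrite add0n A0 subr0 v0; apply.
  by move=> l /andP[_ lp]; apply: vE; apply: (leq_trans lp);
      apply: ltnW (leq_trans lt_pq qn).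
have w2 : walk (n - q) (v p) (a - A q) j.
  have := positions_walk v A q (n - q) _; rewrite subnKC // -vpq An vn; apply.
  by move=> l /andP[_ ln]; exact: vE.
have [|m [b [mI ib chib]]] := IH (p + (n - q))%N _ _ _ _ (walk_cat _ _ _ _ _ _ _ w1 w2).
  by apply: leq_trans nk; rewrite addnC -[X in (_ < X)%N](subnK qn) ltn_add2l.
exists m, b; split => //; apply: le_trans chib.
have -> : chi a = chi (A p + (a - A q)) + chi (A q - A p).
  by rewrite -chiD; congr chi; rewrite [RHS]addrC addrA subrK addrC subrK.
by rewrite gerDl; apply: cyc wcyc; rewrite leq_subLR (leq_trans _ (leq_addl _ _)).
Qed.

Lemma short_walks_finite (s : seq H) : (forall i a j, E i a j -> a \in s) ->
  forall n, exists s' : seq H, forall m i a j, (m <= n)%N -> walk m i a j -> a \in s'.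
Proof.
move=> sP; elim=> [|n [s' s'P]].
  exists [:: 0] => m i a j; rewrite leqn0 => /eqP -> w.
  by case: {1}0%N _ _ _ / w (erefl 0%N) => // *; rewrite mem_head.
exists (s' ++ [seq a + b | a <- s', b <- s]) => m i a j mn w; rewrite mem_cat.
case: m i a j / w mn => [i|m i a j b k w jk] mn; first by rewrite (s'P 0%N i _ i) //;
    exact: walk0.
apply/orP; right; apply: allpairs_f; last exact: sP jk.
exact: s'P w.
Qed.

End Walks.

Lemma finite_bound {R : realType} {A : eqType} (s : seq A) (f : A -> R) :
  exists K, forall a, a \in s -> f a <= K.
Proof.
elim: s => [|b s [K KP]]; first by exists 0.
exists (Num.max K (f b)) => a; rewrite inE le_max => /predU1P[->|/KP ->//].
by rewrite lexx orbT.
Qed.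

(** As [s] is finite, the ratios [al a / be a] have a common upper bound; [e] is the inverse of a
    positive one. Where [be a = 0] the ratio says nothing and the implication takes over. *)
Lemma small_multiple {R : realType} {A : eqType} (s : seq A) (al be : A -> R) :
  exists2 e, 0 < e & forall a, a \in s -> be a <= 0 -> al a <= 0 ->
    (be a = 0 -> al a = 0) -> be a - e * al a <= 0.
Proof.
have [K KP] := finite_bound s (fun a => al a / be a).
have e0 : 0 < (Num.max 1 K)^-1 by rewrite invr_gt0 lt_max ltr01.
exists (Num.max 1 K)^-1 => // a as_ be0 al0 ab.
move: be0; rewrite le_eqVlt => /predU1P[b0|b0]; first by rewrite b0 ab // mulr0 subr0.
have : al a / be a <= Num.max 1 K by rewrite le_max KP ?orbT.
rewrite ler_ndivrMr // => h.
have := ler_wpM2l (ltW e0) h; rewrite mulrA mulVf ?mul1r; last by rewrite -invr_eq0 gt_eqF.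
by rewrite subr_le0.
Qed.

(** * Chains as walks in a finite graph *)

Section Graph.
Context {R : realType} {X : topologicalType} {H : zmodType}.
Context {act : H -> X -> X} {psi : R -> X -> X} {d : X -> X -> R} {T : R}.
Hypothesis cs : cocompact_system act psi d T.

Let T_gt0 := cs_T _ _ _ _ cs.
Let dP := cs_metric _ _ _ _ cs.
Let psiP := cs_flow _ _ _ _ cs.
Let act0 := cs_act0 _ _ _ _ cs.
Let actD := cs_actD _ _ _ _ cs.
Let isom := cs_isom _ _ _ _ cs.
Let comm := cs_comm _ _ _ _ cs.

Local Notation step := (step psi d T).
Local Notation chain := (chain psi d T).

(** The upper bound on the flow time gives uniform error estimates along a step and, by compactness
    of [[T, 2T]], finitely many labels in the graph. *)
Definition short_step (eps : R) (x y : X) :=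
  exists2 tau, T <= tau <= 2 * T & d (psi tau x) y < eps.

(** If empty chains were allowed, [a = 0] would make every point recurrent. *)
Definition nonempty_chain eps x z := exists2 y, step eps x y & chain eps y z.

Lemma step_of_short eps x y : short_step eps x y -> step eps x y.
Proof. by move=> [tau /andP[Tt _] xy]; exists tau. Qed.

Lemma short_le eps eps' x y : eps <= eps' -> short_step eps x y -> short_step eps' x y.
Proof. by move=> le [tau Tt xy]; exists tau => //; exact: lt_le_trans le. Qed.

Lemma short_chain eps x y : rtc (short_step eps) x y -> chain eps x y.
Proof. by apply: (rtc_map id) => a b; exact: step_of_short. Qed.

Lemma rtc_head {N : Type} {S : N -> N -> Prop} x z : rtc S x z ->
  x = z \/ exists2 y, S x y & rtc S y z.
Proof.
elim=> [|a b _ [<-|[y xy ya]] ab]; [by left|right|right].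
  by exists b => //; exact: rtc_refl.
by exists y => //; exact: rtc_rcons ab.
Qed.

Lemma nonempty_chain_chain eps x z : nonempty_chain eps x z -> chain eps x z.
Proof. by move=> [y xy]; apply: rtc_trans; exact: rtc1. Qed.

Lemma step_nonempty_chain eps x y z : step eps x y -> chain eps y z ->
    nonempty_chain eps x z.
Proof. by exists y. Qed.

Lemma chain_nonempty_chain eps x z : chain eps x z -> x = z \/ nonempty_chain eps x z.
Proof. exact: rtc_head. Qed.

Lemma nonempty_chain_trans eps x y z : nonempty_chain eps x y -> chain eps y z ->
    nonempty_chain eps x z.
Proof. by move=> [w xw wy] yz; exists w => //; exact: rtc_trans yz. Qed.

Lemma chain_nonempty_chain_trans eps x y z : chain eps x y -> nonempty_chain eps y z ->
    nonempty_chain eps x z.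
Proof.
move=> /chain_nonempty_chain[->//|xy] /nonempty_chain_chain; exact: nonempty_chain_trans.
Qed.

Lemma nonempty_chain_le eps eps' x y : eps <= eps' -> nonempty_chain eps x y ->
    nonempty_chain eps' x y.
Proof.
by move=> le [z xz zy]; exists z; [exact: step_le xz|exact: chain_le zy].
Qed.

(** Segments of length exactly [T], without jump, are split off as long as the remaining flow time
    exceeds [2T]; it thus never drops below [T]. *)
Lemma step_subdivide eps x y : step eps x y ->
    exists2 z, short_step eps x z & rtc (short_step eps) z y.
Proof.
have T0 := T_gt0; move=> [tau Tt xy].
have e0 : 0 < eps by apply: le_lt_trans xy; exact: metric_ge0.
suff main n : forall t x', T <= t < T *+ n.+2 -> d (psi t x') y < eps ->
    exists2 z, short_step eps x' z & rtc (short_step eps) z y.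
  have tT : 0 <= tau / T by apply: divr_ge0; lra.
  apply: (main (Num.bound (tau / T)) tau x) => //; rewrite Tt /=.
  rewrite -mulr_natr -ltr_pdivrMl // mulrC (lt_le_trans (archi_boundP tT)) //.
  by rewrite ler_nat leqW.
elim: n => [|n IH] t x' /andP[Tt' tn] x'y.
  exists y; last exact: rtc_refl.
  by exists t => //; rewrite Tt' /=; move: tn; rewrite mulr2n; lra.
have [t2|t2] := leP t (2 * T); first by exists y; [exists t; rewrite ?Tt'|exact: rtc_refl].
have [||z z1 zy] := IH (t - T) (psi T x').
- by move: tn; rewrite mulrS; lra.
- by rewrite -(flowD psi psiP) subrK.
exists (psi T x'); first by exists T; [lra|rewrite (metric_refl dP)].
exact: rtc_trans (rtc1 _ _ z1) zy.
Qed.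

Lemma chain_short eps x y : chain eps x y -> rtc (short_step eps) x y.
Proof.
elim=> [|a b _ xa /step_subdivide[z az zb]]; first exact: rtc_refl.
by apply: rtc_trans xa _; exact: rtc_trans (rtc1 _ _ az) zb.
Qed.

Lemma nonempty_chain_short eps x y : nonempty_chain eps x y ->
    exists2 z, short_step eps x z & rtc (short_step eps) z y.
Proof.
move=> [w /step_subdivide[z xz zw] /chain_short wy].
by exists z => //; exact: rtc_trans wy.
Qed.

Lemma short_act eps a x y : short_step eps x y -> short_step eps (act a x) (act a y).
Proof. by move=> [tau Tt xy]; exists tau => //; rewrite comm isom. Qed.

Lemma chain_act eps a x y : chain eps x y -> chain eps (act a x) (act a y).
Proof.
by apply: rtc_map => b c [tau Tt bc]; exists tau => //; rewrite comm isom.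
Qed.

Lemma nonempty_chain_act eps a x y : nonempty_chain eps x y ->
    nonempty_chain eps (act a x) (act a y).
Proof.
move=> [z [tau Tt xz] zy]; exists (act a z); last exact: chain_act.
by exists tau => //; rewrite comm isom.
Qed.

(* Chains project to walks in a finite graph whose vertices are the orbits of a
   net [p] and whose edges carry the deck transformation that relates the lifts;
   conversely an edge is a chain step with a larger error. *)
Lemma chain_graph eps : 0 < eps ->
  exists (n : nat) (p : 'I_n -> X) (E : 'I_n -> H -> 'I_n -> Prop) (del : R) (s : seq H),
  [/\ 0 < del <= eps, (forall x, exists i a, d x (act a (p i)) < del),
      forall x y i a j b, d x (act a (p i)) < del -> d y (act b (p j)) < del ->
        short_step del x y -> E i (b - a) j,
      forall i a j, E i a j -> short_step eps (p i) (act a (p j)) &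
      forall i a j, E i a j -> a \in s].
Proof.
move=> eps0; case: (cs_free _ _ _ _ cs) => r r0 free.
(* Two labels of edges from [i] to [j] seen at nearby times move [p j] to points less than
   [4 * eps'] apart, so freeness at scale [r] makes them equal. *)
pose eps' := Num.min eps (r / 4).
have eps'0 : 0 < eps' by rewrite lt_min eps0; lra.
have eps'e : eps' <= eps by rewrite ge_min lexx.
have eps'r : eps' <= r / 4 by rewrite ge_min lexx orbT.
have e3 : 0 < eps' / 3 by lra.
have [h h0 hP] := flow_uniform cs (2 * T) (eps' / 3) e3.
(* One third of [eps'] each for the flowed distance from [x] to the net, for the jump, and for the
   distance from [y] to the net. *)
pose del := Num.min h (eps' / 3).
have del0 : 0 < del by rewrite lt_min h0.
have delh : del <= h by rewrite ge_min lexx.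
have dele : del <= eps' / 3 by rewrite ge_min lexx orbT.
have [n [p net]] := finite_net cs del del0.
exists n, p, (fun i a j => short_step eps' (p i) (act a (p j))), del.
have fin i j : exists s : seq H, forall a, short_step eps' (p i) (act a (p j)) -> a \in s.
  have /compact_near_coveringP := @segment_compact R T (2 * T).
  move=> /(_ (seq H) supseq (fun (s :
      seq H) t => forall a, d (psi t (p i)) (act a (p j)) < eps' ->
    a \in s) _) [t _|s0 sP].
    have : \forall t' \near t, d (psi t (p i)) (psi t' (p i)) < eps'.
      exact: (flow_continuous_time psi psiP (p i) t _ (nbhs_metric dP _ _ eps'0)).
    move=> nt; have [[a0 ta0]|no] :=
        pselect (exists a, d (psi t (p i)) (act a (p j)) < 2 * eps').
      exists ([set t' | d (psi t (p i)) (psi t' (p i)) < eps'], (fun s :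
          seq H => is_true (a0 \in s))).
        by split => //; exact: near_supseq.
      move=> [t' s] /= [tt' a0s] a t'a.
      have ta := metric_triangle dP (psi t' (p i)) (psi t (p i)) (act a (p j)).
      have := metric_triangle dP (psi t (p i)) (act a0 (p j)) (act a (p j)).
      rewrite (metric_sym dP (act a0 _) (psi t _)) => aa0.
      suff -> : a = a0 by [].
      apply/eqP; rewrite -subr_eq0; apply/eqP/(free _ (act a0 (p j))).
      by rewrite -actD subrK; lra.
    exists ([set t' | d (psi t (p i)) (psi t' (p i)) < eps'], setT).
      by split => //; exact: filterT.
    move=> [t' s] /= [tt' _] a t'a; exfalso; apply: no; exists a.
    by have := metric_triangle dP (psi t' (p i)) (psi t (p i)) (act a (p j)); lra.
  by exists s0 => a [tau Tt pa]; apply: (sP s0) pa => //; rewrite /= in_itv.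
have [F FP] := choice (fun ij : 'I_n * 'I_n => fin ij.1 ij.2).
exists (flatten (codom F)); split => //.
- by rewrite del0; lra.
- move=> x y i a j b xa yb [tau Tt xy]; exists tau => //.
  have t2 : `|tau| <= 2 * T by have := T_gt0; rewrite ger0_norm; lra.
  have h1 := hP _ _ _ t2 (lt_le_trans xa delh).
  rewrite -(isom a) -comm -actD addrC subrK.
  have := metric_triangle dP (psi tau x) (psi tau (act a (p i))) (act b (p j)).
  have := metric_triangle dP y (psi tau x) (act b (p j)).
  rewrite (metric_sym dP (psi tau (act a _)) (psi tau x)).
  by lra.
- by move=> i a j; exact: short_le.
- move=> i a j ij; apply/flattenP; exists (F (i, j)); first exact: codom_f.
  exact: (FP (i, j)).
Qed.

(** A chain from [x] to [act a x] is the lift of a periodic pseudo-orbit of class [a]. *)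
Definition nonpos_cycles (eps : R) (al : H -> R) := forall a x, chain eps x (act a x) ->
    al a <= 0.

(** Up to a bounded error, [f] changes along a chain by the value of [al] on the label of a walk.
    [walk_reduce] bounds that value by the one on a walk with at most [n] edges, and such walks have
    finitely many labels. *)
Lemma chain_bounded eps al f : 0 < eps -> {morph al : a b / a + b} ->
    nonpos_cycles eps al ->
  continuous f -> (forall a x, f (act a x) = f x + al a) ->
  exists C del, [/\ 0 <= C, 0 < del & forall x y, chain del x y -> f y - C <= f x].
Proof.
move=> eps0 alD negal fc fE; have [e e0 eP] := equivariant_uniform cs al f fc fE.
have e20 : 0 < Num.min eps e by rewrite lt_min eps0.
have [n [p [E [del [s [/andP[del0 dele] net edge Eshort Es]]]]]] := chain_graph _ e20.
have dele' : del <= e by move: dele; rewrite le_min => /andP[].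
have walk_chain m i a j : walk E m i a j -> chain eps (p i) (act a (p j)).
  elim=> [k|m' i' a' j' b k _ IH /Eshort jk]; first by rewrite act0; exact: rtc_refl.
  apply: rtc_rcons IH _; rewrite actD; apply: step_of_short; apply: short_act.
  by apply: short_le jk; rewrite ge_min lexx.
have cyc m i a : (m <= #|'I_n|)%N -> walk E m i a i -> al a <= 0.
  by move=> _ /walk_chain; exact: negal.
have [s' s'P] := short_walks_finite E s Es #|'I_n|.
have [K1 K1P] := finite_bound s' al.
have [K2 K2P] := finite_bound (enum 'I_n) (fun i => `|f (p i)|).
have {}K2P i : `|f (p i)| <= K2 by apply: K2P; rewrite mem_enum.
(* [K1] bounds [al] on short walks, [2 * K2] the values of [f] at two net points, and [2] the
   passage from [x] and [y] to the net. *)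
pose C := Num.max 0 (K1 + 2 * K2 + 2).
exists C, del; split => //; first by rewrite le_max lexx.
have C0 : 0 <= C by rewrite le_max lexx.
have C1 : K1 + 2 * K2 + 2 <= C by rewrite le_max lexx orbT.
move=> x y /chain_nonempty_chain[<-|/nonempty_chain_short[z xz zy]]; first by lra.
have cw w : rtc (short_step del) z w -> forall i a j b, d x (act a (p i)) < del ->
    d w (act b (p j)) < del -> exists m, walk E m i (b - a) j.
  elim=> [|u w' _ IH uw] i a j b xa wb.
    by exists 1%N; rewrite -[b - a]add0r; apply: (walkS E _ _ _ i);
        [exact: walk0|exact: edge xz].
  have [k [c uc]] := net u; have [m wm] := IH _ _ _ _ xa uc.
  exists m.+1; have -> : b - a = (c - a) + (b - c) by rewrite [RHS]addrC addrA subrK.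
  by apply: walkS wm _; exact: edge uw.
have [i [a xa]] := net x; have [j [b yb]] := net y.
have [m wm] := cw _ zy _ _ _ _ xa yb.
have [m' [c [m'n wc lec]]] := walk_reduce E al alD cyc _ _ _ _ wm.
have cK := K1P c (s'P _ _ _ _ m'n wc).
have := eP _ _ (lt_le_trans xa dele'); have := eP _ _ (lt_le_trans yb dele').
have := K2P i; have := K2P j; rewrite !fE !ler_norml.
have : al b = al (b - a) + al a by rewrite -alD subrK.
by lra.
Qed.

(** Walks are chains of error [eps], so the hypotheses apply to the finitely many short closed walks
    and [small_multiple] yields [s]. Chains of the smaller error [del] project to walks, where
    [walk_reduce] extends the inequality. *)
Lemma nonpos_cycles_sub eps (al be : H -> R) : 0 < eps ->
  {morph al : a b / a + b} -> {morph be : a b / a + b} -> nonpos_cycles eps al ->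
      nonpos_cycles eps be ->
  (forall a x, chain eps x (act a x) -> be a = 0 -> al a = 0) ->
  exists s del, [/\ 0 < s, 0 < del & nonpos_cycles del (fun a => be a - s * al a)].
Proof.
move=> eps0 alD beD negal negbe null.
have [n [p [E [del [s [/andP[del0 dele] net edge Eshort Es]]]]]] := chain_graph _ eps0.
have walk_chain m i a j : walk E m i a j -> chain eps (p i) (act a (p j)).
  elim=> [k|m' i' a' j' b k _ IH /Eshort jk]; first by rewrite act0; exact: rtc_refl.
  by apply: rtc_rcons IH _; rewrite actD; apply: step_of_short; exact: short_act.
have [s' s'P] := short_walks_finite E s Es #|'I_n|.
have [c c0 cP] := small_multiple s' al be.
pose chi a := be a - c * al a.
have chiD : {morph chi : a b / a + b}.
  by move=> a b; rewrite /chi alD beD mulrDr opprD addrACA.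
have cyc m i a : (m <= #|'I_n|)%N -> walk E m i a i -> chi a <= 0.
  move=> mn w; have ch := walk_chain _ _ _ _ w; apply: cP; first exact: s'P w.
  - exact: negbe ch.
  - exact: negal ch.
  - exact: null ch.
exists c, del; split => // a x /chain_nonempty_chain[xax|/nonempty_chain_short[z xz zy]].
  have -> : a = 0 by apply: (act_inj cs x); rewrite act0 -xax.
  have al0 : al 0 = 0 by apply: (addrI (al 0)); rewrite -alD !addr0.
  have be0 : be 0 = 0 by apply: (addrI (be 0)); rewrite -beD !addr0.
  by rewrite al0 be0 mulr0 subr0.
have cw w : rtc (short_step del) z w -> forall i a j b, d x (act a (p i)) < del ->
    d w (act b (p j)) < del -> exists m, walk E m i (b - a) j.
  elim=> [|u w' _ IH uw] i a' j b xa wb.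
    by exists 1%N; rewrite -[b - a']add0r; apply: (walkS E _ _ _ i);
        [exact: walk0|exact: edge xz].
  have [k [c' uc]] := net u; have [m wm] := IH _ _ _ _ xa uc.
  exists m.+1; have -> : b - a' = (c' - a') + (b - c') by rewrite [RHS]addrC addrA subrK.
  by apply: walkS wm _; exact: edge uw.
(* The same net point serves [x] and its translate [act a x], so the walk is closed and its label is
   exactly [a]. *)
have [i [b xb]] := net x.
have axb : d (act a x) (act (a + b) (p i)) < del by rewrite actD isom.
have [m] := cw _ zy _ _ _ _ xb axb; rewrite addrK => wm.
have [m' [b' [m'n wb leb]]] := walk_reduce E chi chiD cyc _ _ _ _ wm.
by apply: le_trans leb _; exact: cyc wb.
Qed.

End Graph.

(** * Recurrence up to a null class *)

Section Recurrence.
Context {R : realType} {X : topologicalType} {H : zmodType}.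
Context {act : H -> X -> X} {psi : R -> X -> X} {d : X -> X -> R} {T : R}.
Hypothesis cs : cocompact_system act psi d T.

Let T_gt0 := cs_T _ _ _ _ cs.
Let dP := cs_metric _ _ _ _ cs.
Let psiP := cs_flow _ _ _ _ cs.
Let act0 := cs_act0 _ _ _ _ cs.
Let actD := cs_actD _ _ _ _ cs.
Let isom := cs_isom _ _ _ _ cs.
Let comm := cs_comm _ _ _ _ cs.

Local Notation step := (step psi d T).
Local Notation chain := (chain psi d T).
Local Notation short_step := (@short_step _ _ psi d T).
Local Notation nonempty_chain := (@nonempty_chain _ _ psi d T).
Local Notation nonpos_cycles := (@nonpos_cycles _ _ _ act psi d T).

(** Reaching [act a x] with [al a = 0] means closing up in the quotient by the kernel of [al];
    [alpha_recurrentE] makes the comparison. *)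
Definition null_recurrent (al : H -> R) (x : X) :=
  forall eps, 0 < eps -> exists2 a, al a = 0 & nonempty_chain eps x (act a x).

Lemma actC a b x : act a (act b x) = act b (act a x).
Proof. by rewrite -!actD addrC. Qed.

Lemma step_end eps h x y z : step eps x y -> d y z < h -> step (eps + h) x z.
Proof.
move=> [tau Tt xy] yz; exists tau => //.
by have := metric_triangle dP y (psi tau x) z; lra.
Qed.

Lemma nonempty_chain_end eps h x y z : nonempty_chain eps x y -> d y z < h ->
    nonempty_chain (eps + h) x z.
Proof.
move=> [w xw wy] yz; have h0 : 0 <= h by apply: le_trans (ltW yz); exact: metric_ge0.
have le : eps <= eps + h by lra.
case: wy yz => [|u v wu uv] yz.
  by exists z; [exact: step_end yz|exact: rtc_refl].
exists w; first exact: step_le xw.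
by apply: rtc_rcons (step_end _ _ _ _ _ uv yz); exact: chain_le wu.
Qed.

Lemma nonempty_chain_start eps : 0 < eps -> exists2 h, 0 < h <= eps &
  forall x y z, d x y < h -> nonempty_chain h x z -> nonempty_chain eps y z.
Proof.
move=> eps0; have e2 : 0 < eps / 2 by lra.
have [h h0 hP] := flow_uniform cs (2 * T) (eps / 2) e2.
exists (Num.min h (eps / 2)).
  by rewrite lt_min h0 e2 /= ge_min; apply/orP; right; lra.
move=> x y z; rewrite lt_min => /andP[xyh xye] /(nonempty_chain_short cs)[w [tau Tt xw] wz].
exists w; last first.
  by apply: chain_le (short_chain _ _ _ wz); rewrite ge_min; apply/orP; right; lra.
have t2 : `|tau| <= 2 * T by have := T_gt0; rewrite ger0_norm; lra.
exists tau; first by case/andP: Tt.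
have h1 := hP _ _ _ t2 xyh.
move: xw; rewrite lt_min => /andP[_ xw].
have := metric_triangle dP (psi tau x) (psi tau y) w.
by rewrite (metric_sym dP (psi tau y) (psi tau x)); lra.
Qed.

Lemma null_recurrent_act al b x : null_recurrent al x -> null_recurrent al (act b x).
Proof.
move=> rx eps /rx[a al0 xax]; exists a => //.
by rewrite actC; exact: nonempty_chain_act cs _ _ _ _ xax.
Qed.

Lemma null_recurrent_flow al t x : null_recurrent al x -> null_recurrent al (psi t x).
Proof.
move=> rx eps eps0; have [h h0 hP] := flow_uniform cs `|t| eps eps0.
have [a al0 [y xy yax]] := rx _ h0; exists a => //; rewrite -comm.
have stepP u v : step h u v -> step eps (psi t u) (psi t v).
  move=> [tau Tt uv]; exists tau => //.
  by rewrite -(flowD _ psiP) addrC (flowD _ psiP); exact: hP.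
by exists (psi t y); [exact: stepP|apply: rtc_map yax; exact: stepP].
Qed.

(** Moving both ends of a null cycle at [y] yields one at [x] with slightly larger error. So
    non-recurrence is open, with one bound [e] for distance and error. *)
Lemma not_null_recurrent_near al x : ~ null_recurrent al x -> exists2 e, 0 < e &
  forall y h, d x y < e -> 0 < h < e -> forall a, al a = 0 ->
      ~ nonempty_chain h y (act a y).
Proof.
move=> nrx; have [eps eps0 noa] : exists2 eps, 0 < eps &
    forall a, al a = 0 -> ~ nonempty_chain eps x (act a x).
  apply: contrapT => no; apply: nrx => eps eps0; apply: contrapT => noa.
  by apply: no; exists eps => // a al0 xa; apply: noa; exists a.
have e2 : 0 < eps / 2 by lra.
have [h /andP[h0 he] hP] := nonempty_chain_start _ e2;
    exists h => // y k xy /andP[k0 kh] a al0 ya.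
apply: (noa a al0); rewrite [eps]splitr; apply: (nonempty_chain_end _ _ _ (act a y));
    last first.
  by rewrite isom (metric_sym dP); lra.
by apply: (hP y); [rewrite (metric_sym dP)|apply: nonempty_chain_le ya; exact: ltW].
Qed.

(** The intermediate jump is carried along the flow for a time at most [L], at a controlled cost,
    and two flow segments become one. *)
Lemma merge (L eps : R) : 0 < eps -> exists2 h, 0 < h <= eps &
  forall x y z s t, d (psi s x) y < h -> `|t| <= L -> d (psi t y) z < h ->
    d (psi (t + s) x) z < eps.
Proof.
move=> eps0; have e2 : 0 < eps / 2 by lra.
have [h h0 hP] := flow_uniform cs L (eps / 2) e2.
exists (Num.min h (eps / 2)).
  by rewrite lt_min h0 e2 /= ge_min; apply/orP; right; lra.
move=> x y z s t; rewrite !lt_min => /andP[xy _] tL /andP[_ yz].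
have := hP _ _ _ tL xy; rewrite -(flowD _ psiP).
by have := metric_triangle dP (psi t y) (psi (t + s) x) z; lra.
Qed.

(** Three consecutive short steps are merged into one, whose time is therefore in [[3T, 6T]]. *)
Lemma null_recurrent_long al x : {morph al : a b / a + b} -> null_recurrent al x ->
  forall eps, 0 < eps -> exists b w t,
    [/\ al b = 0, 3 * T <= t <= 6 * T, d (psi t x) w < eps & chain eps w (act b x)].
Proof.
move=> alD rx eps eps0; have T0 := T_gt0.
have [h1 /andP[h10 h1e] m1] := merge (2 * T) eps eps0.
have [h /andP[h0 hh1] m2] := merge (2 * T) h1 h10.
have [a al0 /(nonempty_chain_short cs)[y1 xy1 y1a]] := rx _ h0.
(* When the cycle is used up it is repeated from its translate; the class changes by the null class
   [a]. *)
have next z b : al b = 0 -> rtc (short_step h) z (act b x) ->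
    exists z' b', [/\ al b' = 0, short_step h z z' & rtc (short_step h) z' (act b' x)].
  move=> b0 zb; case: (rtc_head _ _ zb) => [->|[z' zz' z'b]]; last by exists z', b.
  exists (act b y1), (b + a); split; first by rewrite alD b0 al0 addr0.
    exact: short_act cs _ _ _ _ xy1.
  by rewrite actD; apply: rtc_map y1a => u v; exact: (short_act cs).
have [y2 [b [b0 y12 y2b]]] := next _ _ al0 y1a.
have [y3 [c [c0 y23 y3c]]] := next _ _ b0 y2b.
case: xy1 y12 y23 => [t1 Tt1 xy1] [t2 Tt2 y12] [t3 Tt3 y23].
exists c, y3, (t3 + (t2 + t1)); split => //; first by lra.
- apply: (m1 x y2); last exact: lt_le_trans hh1.
    by apply: m2 xy1 _ y12; rewrite ger0_norm; lra.
  by rewrite ger0_norm; lra.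
- by apply: chain_le (short_chain _ _ _ y3c); lra.
Qed.

(* By [null_recurrent_long], the chains from [z] back to its orbit can be taken with a
   first flow time [t >= 3 T]. Flowing from [y], which is close to [psi tau z]
   with [tau <= 2 T], for the remaining time [t - tau >= T] is thus a legal first
   step that joins such a chain. *)
Lemma reverse_step al eps : {morph al : a b / a + b} -> 0 < eps ->
  exists2 h, 0 < h & forall z x y, null_recurrent al z -> d x z < h -> short_step h x y ->
    exists2 b, al b = 0 & nonempty_chain eps y (act b x).
Proof.
move=> alD eps0; have T0 := T_gt0; have e4 : 0 < eps / 4 by lra.
have [h1 h10 h1P] := flow_uniform cs (6 * T) _ e4.
have h12 : 0 < h1 / 2 by lra.
have [h2 h20 h2P] := flow_uniform cs (6 * T) _ h12.
pose h := Num.min (Num.min h2 (h1 / 2)) (eps / 2).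
have hh2 : h <= h2 by rewrite !ge_min lexx.
have hh1 : h <= h1 / 2 by rewrite !ge_min lexx orbT.
have he : h <= eps / 2 by rewrite !ge_min lexx !orbT.
exists h; first by rewrite !lt_min h20 h12 /=; lra.
move=> z x y rz xz [tau Ttau xy].
have [b [w [t [b0 Tt zw wb]]]] := null_recurrent_long al z alD rz _ e4.
exists b => //; rewrite [eps]splitr; apply: (nonempty_chain_end _ _ _ (act b z));
    last first.
  by rewrite isom (metric_sym dP); lra.
exists w; last by apply: chain_le wb; lra.
exists (t - tau); first by lra.
have tauL : `|tau| <= 6 * T by rewrite ger0_norm; lra.
have ttL : `|t - tau| <= 6 * T by rewrite ger0_norm; lra.
have yz : d y (psi tau z) < h1.
  have := h2P _ _ _ tauL (lt_le_trans xz hh2).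
  have := metric_triangle dP (psi tau x) y (psi tau z).
  by rewrite (metric_sym dP y (psi tau x)); lra.
have := h1P _ _ _ ttL yz; rewrite -(flowD _ psiP) subrK.
by have := metric_triangle dP (psi t z) (psi (t - tau) y) w; lra.
Qed.

(** A recurrent [x] serves as [z] for all points near it, and near a non-recurrent [x] there are no
    null cycles of small error. Cocompactness makes the error uniform. *)
Lemma near_null_recurrent be h : 0 < h -> exists2 eps, 0 < eps &
  forall x a, be a = 0 -> nonempty_chain eps x (act a x) ->
      exists2 z, null_recurrent be z & d x z < h.
Proof.
move=> h0; apply: (cocompact_eps cs (fun eps x => forall a, be a = 0 ->
    nonempty_chain eps x (act a x) -> exists2 z, null_recurrent be z & d x z < h)).
  move=> b eps x xP a a0 /(nonempty_chain_act cs _ (- b)); rewrite (actC a b) !(actK cs).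
  move=> /(xP a a0)[z rz xz]; exists (act b z); last by rewrite isom.
  exact: null_recurrent_act.
move=> x; have [rx|nrx] := pselect (null_recurrent be x).
  by exists h => // y eps xy _ a _ _; exists x => //; rewrite (metric_sym dP).
have [e e0 eP] := not_null_recurrent_near be x nrx.
by exists e => // y eps xy he a a0 /(eP _ _ xy he a a0).
Qed.

(* The points of a [be]-null cycle of small error are close to the recurrent set
   of [be], hence to that of [al]; so every step can be reversed by an [al]-null
   chain, and the cycle has an inverse up to an [al]-null class. Both classes are
   nonpositive for [al], so they vanish. *)
Lemma null_recurrent_classes al be eps : {morph al : a b / a + b} ->
  0 < eps -> nonpos_cycles eps al -> (forall x, null_recurrent be x ->
      null_recurrent al x) ->
  exists2 e, 0 < e & forall a x, chain e x (act a x) -> be a = 0 -> al a = 0.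
Proof.
move=> alD eps0 negal sub.
have al00 : al 0 = 0 by apply: (addrI (al 0)); rewrite -alD !addr0.
have alN a : al (- a) = - al a by apply: (addrI (al a)); rewrite -alD !subrr.
have [h h0 hP] := reverse_step al eps alD eps0.
have [e e0 eP] := near_null_recurrent be h h0.
pose e' := Num.min (Num.min e h) eps.
have e'e : e' <= e by rewrite !ge_min lexx.
have e'h : e' <= h by rewrite !ge_min lexx orbT.
have e'eps : e' <= eps by rewrite !ge_min lexx !orbT.
exists e'; first by rewrite !lt_min e0 h0 eps0.
move=> a x xax be0; have ale := negal _ _ (chain_le _ _ _ _ _ _ _ e'eps xax).
suff back y : rtc (short_step e') x y -> rtc (short_step e') y (act a x) ->
    exists2 b, al b = 0 & chain eps y (act b x).
  (* The reversed cycle goes from [act a x] to [act b x] and has class [b - a]; as [al b = 0], its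
     nonpositivity gives [0 <= al a]. *)
  have [b b0] := back (act a x) (chain_short cs _ _ _ xax) (rtc_refl _ _).
  move=> /(chain_act cs _ (- a)); rewrite (actK cs) -actD => /negal.
  rewrite alD alN b0 addr0 oppr_le0 => alg.
  by apply/eqP; rewrite eq_le ale.
elim=> [_|y0 {}y xy0 IH y0y yax].
  by exists 0 => //; rewrite act0; exact: rtc_refl.
have y0ax : rtc (short_step e') y0 (act a x) by exact: rtc_trans (rtc1 _ _ y0y) yax.
have [b b0 y0b] := IH y0ax.
(* Rotating the cycle to start at [y0] keeps its class [a]. *)
have y0y0 : nonempty_chain e' y0 (act a y0).
  apply: (step_nonempty_chain _ _ y); first exact: step_of_short.
  apply: rtc_trans (short_chain _ _ _ yax) _.
  exact: chain_act cs _ _ _ _ (short_chain _ _ _ xy0).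
have [z rz y0z] := eP _ _ be0 (nonempty_chain_le _ _ _ _ e'e y0y0).
have [c c0 yc] := hP z y0 y (sub _ rz) y0z (short_le _ _ _ _ e'h y0y).
exists (c + b); first by rewrite alD b0 c0 addr0.
apply: rtc_trans (nonempty_chain_chain _ _ _ yc) _; rewrite actD.
exact: chain_act cs _ _ _ _ y0b.
Qed.

Lemma null_recurrent_incl al be s eps x : 0 < s -> 0 < eps -> nonpos_cycles eps al ->
  nonpos_cycles eps (fun a => be a - s * al a) -> null_recurrent be x ->
      null_recurrent al x.
Proof.
move=> s0 eps0 negal negbe rx e e0.
have m0 : 0 < Num.min e eps by rewrite lt_min e0.
have [a a0 xa] := rx _ m0; exists a; last by apply: nonempty_chain_le xa;
    rewrite ge_min lexx.
have xa' : chain eps x (act a x).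
  by apply/nonempty_chain_chain/(nonempty_chain_le _ _ _ _ _ xa); rewrite ge_min lexx orbT.
have := negbe _ _ xa'; rewrite a0 sub0r oppr_le0 pmulr_rge0 // => ag.
by apply/eqP; rewrite eq_le (negal _ _ xa').
Qed.

(** Adapts recurrence to pseudo-orbits, which end with a jump-free segment of any positive length. A
    return of [psi (- T) x] provides it: [x] lies on the first flow segment, of time at least [3T],
    and flowing for [T] at the end reaches [act b x]. Conversely, a final segment shorter than [T]
    is absorbed into the preceding step. *)
Lemma null_recurrent_flowed al x : {morph al : a b / a + b} ->
  (null_recurrent al x <-> forall eps, 0 < eps -> exists a z tau,
    [/\ al a = 0, chain eps x z, 0 < tau & psi tau z = act a x]).
Proof.
move=> alD; have T0 := T_gt0.
have al00 : al 0 = 0 by apply: (addrI (al 0)); rewrite -alD !addr0.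
split=> [rx eps eps0|rx eps eps0].
  have [b [w [t [b0 Tt xw wb]]]] :=
      null_recurrent_long al _ alD (null_recurrent_flow al (- T) x rx) eps eps0.
  exists b, (act b (psi (- T) x)), T; split => //; last first.
    by rewrite comm -(flowD _ psiP) subrr (flow0 _ psiP).
  apply: rtc_trans (rtc1 _ _ _) wb; exists (t - T); first by lra.
  by rewrite (flowD _ psiP).
have [h h0 hP] := flow_uniform cs T eps eps0.
have m0 : 0 < Num.min h eps by rewrite lt_min h0.
have [a [z [tau [a0 xz tau0 zE]]]] := rx _ m0.
have m_eps : Num.min h eps <= eps by rewrite ge_min lexx orbT.
have [Ttau|tauT] := leP T tau.
  exists a => //; apply: (chain_nonempty_chain_trans _ _ z); first exact: chain_le xz.
  exists (act a x); last exact: rtc_refl.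
  by exists tau => //; rewrite zE (metric_refl dP).
(* Without a preceding step, [x] flows to [act a x] in time [tau]; repeating this until the total
   time exceeds [T] gives a step. *)
case: xz zE => [xE|y {}z xy [sig Tsig yz] zE].
  have iter n : psi (tau *+ n) x = act (a *+ n) x.
    elim: n => [|n IH]; first by rewrite !mulr0n act0 (flow0 _ psiP).
    by rewrite !mulrS (flowD _ psiP) IH comm xE actC -actD addrC.
  have aln n : al (a *+ n) = 0.
    by elim: n => [|n IH]; rewrite ?mulr0n // mulrS alD IH a0 addr0.
  exists (a *+ Num.bound (T / tau)) => //.
  exists (act (a *+ Num.bound (T / tau)) x); last exact: rtc_refl.
  exists (tau *+ Num.bound (T / tau)); last by rewrite iter (metric_refl dP).
  have tT : 0 <= T / tau by apply: divr_ge0; lra.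
  by rewrite -mulr_natr -ler_pdivrMl // mulrC ltW // archi_boundP.
exists a => //; apply: (chain_nonempty_chain_trans _ _ y); first exact: chain_le xy.
exists (act a x); last exact: rtc_refl.
exists (tau + sig); first by lra.
rewrite -zE (flowD _ psiP); apply: hP; first by rewrite ger0_norm; lra.
by apply: lt_le_trans yz _; rewrite ge_min lexx.
Qed.

End Recurrence.

(** * Quasi-Lyapunov classes *)

Section QuasiLyapunovCriterion.
Context {R : realType} {X : topologicalType} {H : zmodType}.
Context {act : H -> X -> X} {psi : R -> X -> X} {d : X -> X -> R} {T : R}.
Hypothesis cs : cocompact_system act psi d T.

Let T_gt0 := cs_T _ _ _ _ cs.
Let dP := cs_metric _ _ _ _ cs.
Let psiP := cs_flow _ _ _ _ cs.
Let act0 := cs_act0 _ _ _ _ cs.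
Let actD := cs_actD _ _ _ _ cs.
Let isom := cs_isom _ _ _ _ cs.
Let comm := cs_comm _ _ _ _ cs.

Lemma dist_continuous q : continuous (d^~ q).
Proof.
move=> x; apply/cvgrPdist_lt => e e0.
have := nbhs_metric dP x e e0; apply: filterS => y /= xy.
have := metric_triangle dP y x q; have := metric_triangle dP x y q.
by rewrite (metric_sym dP y x) ltr_norml; lra.
Qed.

Lemma near_eq_continuous (f g : X -> R) x : {for x, continuous g} ->
  (\forall y \near x, f y = g y) -> {for x, continuous f}.
Proof.
move=> gc fg; rewrite /prop_for /continuous_at (nbhs_singleton fg).
apply: cvg_trans gc; apply: near_eq_cvg.
by apply: filterS fg => y ->.
Qed.

(* Partition of unity: over each ball of the net, [f] is the value of [al] at the
   deck transformation that labels the sheet. *)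
Lemma equivariant_exists (al : H -> R) : {morph al : a b / a + b} ->
  exists2 f : X -> R, continuous f & forall a x, f (act a x) = f x + al a.
Proof.
move=> alD; case: (cs_free _ _ _ _ cs) => r r0 free.
(* With a quarter of [r], even the balls of radius [2 * eta] around the translates of one net point
   are disjoint, so labels are unique. *)
pose eta := r / 4; have eta0 : 0 < eta by rewrite /eta; lra.
have [n [p net]] := finite_net cs eta eta0.
have uniq a b q : d (act a q) (act b q) < r -> a = b.
  move=> ab; apply/eqP; rewrite eq_sym -subr_eq0; apply/eqP/(free _ (act a q)).
  by rewrite -actD subrK.
have uniq2 a b q x : d x (act a q) < 2 * eta -> d x (act b q) < 2 * eta -> a = b.
  move=> xa xb; apply: (uniq _ _ q); rewrite /eta in xa xb.
  by have := metric_triangle dP x (act a q) (act b q); rewrite (metric_sym dP _ x); lra.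
(* The default label [0], taken outside all balls, is harmless: the other factor of [bump] vanishes
   there. *)
pose lab i x := xget 0 [set a | d x (act a (p i)) < eta].
have labE i x a : d x (act a (p i)) < eta -> lab i x = a.
  move=> xa; have xl : d x (act (lab i x) (p i)) < eta.
    exact: (@xgetPex _ 0 [set a | d x (act a (p i)) < eta]) (ex_intro _ a xa).
  by apply: (uniq2 _ _ (p i) x); lra.
pose bump i (w : H -> R) x := Num.max 0 (eta - d x (act (lab i x) (p i))) * w (lab i x).
have bumpE i w x a : d x (act a (p i)) < eta ->
    bump i w x = (eta - d x (act a (p i))) * w a.
  move=> xa; rewrite /bump (labE _ _ _ xa); congr (_ * _).
  by apply/max_idPr; lra.
have bump0 i w x : (forall a, ~ d x (act a (p i)) < eta) -> bump i w x = 0.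
  move=> no; rewrite /bump (_ : Num.max _ _ = 0) ?mul0r //.
  by apply/max_idPl; rewrite subr_le0 leNgt; apply/negP/no.
have bumpc i w : continuous (bump i w).
  move=> x; have [[a xa]|no] := pselect (exists a, d x (act a (p i)) < 2 * eta).
    apply: (near_eq_continuous _ (fun y => Num.max 0 (eta - d y (act a (p i))) * w a)).
      apply: cvgMl; apply: (@continuous_max _ _ (fun=> 0 : R^o)
        (fun y => (eta - d y (act a (p i)) : R^o)) x); first exact: cst_continuous.
      by apply: cvgB; [exact: cvg_cst|exact: dist_continuous].
    have := nbhs_metric dP x eta eta0; apply: filterS => y /= xy.
    have [ya|ya] := ltP (d y (act a (p i))) eta.
      by rewrite (bumpE _ _ _ _ ya) (max_idPr _) //; lra.
    rewrite bump0 ?(max_idPl _) ?mul0r //; first by rewrite subr_le0.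
    move=> b yb; have ab : a = b.
      apply: (uniq2 _ _ (p i) x) => //.
      by have := metric_triangle dP y x (act b (p i)); lra.
    by move: yb; rewrite -ab; lra.
  apply: (near_eq_continuous _ (fun=> 0)); first exact: cst_continuous.
  have := nbhs_metric dP x eta eta0; apply: filterS => y /= xy.
  apply: bump0 => a ya; apply: no; exists a.
  by have := metric_triangle dP y x (act a (p i)); lra.
have bump_act i w b x : (exists2 a, bump i w x = (eta - d x (act a (p i))) * w a &
      bump i w (act b x) = (eta - d x (act a (p i))) * w (b + a)) \/
    (bump i w x = 0 /\ bump i w (act b x) = 0).
  have [[a xa]|no] := pselect (exists a, d x (act a (p i)) < eta).
    left; exists a; first exact: bumpE.
    by rewrite (bumpE _ _ _ (b + a)) actD isom.
  right; split; apply: bump0 => a xa; apply: no; first by exists a.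
  by exists (- b + a); rewrite actD -[d _ _](isom b) (actNK cs).
have den0 x : 0 < \sum_i bump i (fun=> 1) x.
  have [i [a xa]] := net x; rewrite (bigD1 i) //=; apply: ltr_pwDl.
    by rewrite (bumpE _ _ _ _ xa) /= mulr1 subr_gt0.
  by apply: sumr_ge0 => j _; rewrite /bump /= mulr1 le_max lexx.
exists (fun x => (\sum_i bump i al x) / (\sum_i bump i (fun=> 1) x)).
  have sumc w : continuous (fun x => \sum_i bump i w x).
    by apply: continuous_big => [|i _]; [exact: add_continuous|exact: bumpc].
  move=> x; apply: cvgM; first exact: sumc.
  by apply: cvgV; [rewrite gt_eqF|exact: (sumc (fun=> 1) x)].
move=> b x.
have -> : \sum_i bump i (fun=> 1) (act b x) = \sum_i bump i (fun=> 1) x.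
  by apply: eq_bigr => i _; case: (bump_act i (fun=> 1) b x) => [[a -> ->]|[-> ->]].
have -> : \sum_i bump i al (act b x) = \sum_i bump i al x + al b * \sum_i bump i
    (fun=> 1) x.
  rewrite mulr_sumr -big_split /=; apply: eq_bigr => i _.
  have [[a xa]|no] := pselect (exists a, d x (act a (p i)) < eta).
    rewrite !(bumpE _ _ _ _ xa) (bumpE _ _ _ (b + a)) actD isom // alD /= mulr1.
    by rewrite mulrDr addrC [al b * _]mulrC.
  rewrite !bump0 ?mulr0 ?addr0 // => a xa; apply: no; try by exists a.
  by exists (- b + a); rewrite actD -[d _ _](isom b) (actNK cs).
by rewrite mulrDl mulfK // gt_eqF.
Qed.

(** Going [n] times around a cycle of class [a] bounds [n] times [al a] by [C] for an equivariant
    [f], whence the sign. Conversely, [chain_bounded] controls the chains, and the drift of [f] a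
    final segment shorter than [T]. *)
Lemma quasi_Lyapunov_nonpos_cycles (al : H -> R) : {morph al : a b / a + b} ->
  (forall f : X -> R, continuous f -> (forall a x, f (act a x) = f x + al a) ->
     exists C eps, [/\ 0 <= C, 0 < eps & forall l gam, pseudo_orbit psi d T eps l gam ->
       forall t, 0 <= t < l -> f (gam t) - C <= f (gam 0)]) <->
  (exists2 eps, 0 < eps & nonpos_cycles (act := act) (psi := psi) (d := d) (T := T) eps al).
Proof.
move=> alD; have T0 := T_gt0; split=> [ql|[eps eps0 negal] f fc fE].
  have [f fc fE] := equivariant_exists al alD.
  have [C [eps [C0 eps0 fP]]] := ql f fc fE; exists eps => // a x xa.
  have iter n : chain psi d T eps x (act (a *+ n) x).
    elim: n => [|n IH]; first by rewrite mulr0n act0; exact: rtc_refl.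
    rewrite mulrSr actD; apply: (rtc_trans (act (a *+ n) x)) => //.
    exact: (chain_act cs).
  have aln n : al (a *+ n) = al a *+ n.
    elim: n => [|n IH]; last by rewrite !mulrS alD IH.
    by rewrite !mulr0n; apply: (addrI (al 0)); rewrite -alD !addr0.
  rewrite leNgt; apply/negP => ala0.
  have bound n : al a *+ n <= C.
    have [l [gam [po g0 _ [t tl gt]]]] :=
        chain_pseudo_orbit psi d T T0 dP psiP _ _ _ 1 (iter n) ltr01.
    by have := fP _ _ po _ tl; rewrite gt g0 fE aln; lra.
  have := bound (Num.bound (C / al a)); rewrite leNgt => /negP; apply.
  rewrite -mulr_natr -ltr_pdivrMl // mulrC; apply: archi_boundP.
  by apply: divr_ge0 => //; exact: ltW.
have [C [del [C0 del0 bound]]] := chain_bounded cs eps al f eps0 alD negal fc fE.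
have [K KP] := equivariant_drift cs al f T fc fE.
exists (C + Num.max 0 K), del; split => //.
  by apply: addr_ge0 => //; rewrite le_max lexx.
have K0 : 0 <= Num.max 0 K by rewrite le_max lexx.
have K1 : K <= Num.max 0 K by rewrite le_max lexx orbT.
move=> l gam /(pseudo_orbit_chain psi d T T0 dP psiP)[po _] t /po[y [tau [xy tau0 ->]]].
have [Ttau|tauT] := leP T tau.
  have xy' : chain psi d T del (gam 0) (psi tau y).
    by apply: rtc_rcons xy _; exists tau => //; rewrite (metric_refl dP).
  by have := bound _ _ xy'; lra.
have := bound _ _ xy; have := KP y tau; rewrite !ler_norml => h.
by have := h ltac:(lra); lra.
Qed.

End QuasiLyapunovCriterion.

(** * Coverings *)

Section Coverings.
Context {R : realType} {N M : topologicalType}.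
Variables (p : N -> M) (dM : M -> M -> R) (dN : N -> N -> R).
Hypothesis dMP : compatible_metric dM.

(** Being isometric on balls of radius [r], [p] is injective there, so two lifts agree on an open
    set; it is closed because [dN] separates points. *)
Lemma lift_unique (c1 c2 : R -> N) : covering_metric p dM dN ->
  continuous c1 -> continuous c2 -> (forall t, p (c1 t) = p (c2 t)) ->
  c1 0 = c2 0 -> forall t, c1 t = c2 t.
Proof.
move=> [dP _ [r r0 rP]] c1c c2c pc c0 t.
suff eqT : [set t | c1 t = c2 t] = [set: R].
  by have : [set: R] t by []; rewrite -eqT.
have /connected_intervalP : is_interval [set: R] by [].
apply; first by exists 0.
- exists [set t | c1 t = c2 t]; last by rewrite setTI.
  rewrite openE => s /= cs; rewrite /interior.
  have n1 := c1c s _ (nbhs_metric dP (c1 s) r r0).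
  have n2 := c2c s _ (nbhs_metric dP (c2 s) r r0).
  near=> u; apply: (metric_eq0 dP); rewrite -(rP (c1 s)).
  + by rewrite pc (metric_refl dMP).
  + by near: u.
  + by rewrite cs; near: u.
- exists [set t | c1 t = c2 t]; last by rewrite setTI.
  rewrite -openC openE => s /= cs; rewrite /interior.
  have d0 : 0 < dN (c1 s) (c2 s).
    rewrite lt_neqAle (metric_ge0 dP) andbT eq_sym; apply/eqP => d0.
    by apply: cs; exact: (metric_eq0 dP).
  have e0 : 0 < dN (c1 s) (c2 s) / 2 by lra.
  have n1 := c1c s _ (nbhs_metric dP (c1 s) _ e0).
  have n2 := c2c s _ (nbhs_metric dP (c2 s) _ e0).
  near=> u; move=> /= cu.
  have h1 : dN (c1 s) (c1 u) < dN (c1 s) (c2 s) / 2 by near: u.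
  have h2 : dN (c2 s) (c2 u) < dN (c1 s) (c2 s) / 2 by near: u.
  have := metric_triangle dP (c1 u) (c1 s) (c2 s).
  by rewrite (metric_sym dP (c1 u) (c2 s)) cu; rewrite cu in h1; lra.
Unshelve. all: end_near. Qed.

Lemma covering_nbhs x (A : set N) : covering_map p -> nbhs x A -> nbhs (p x) (p @` A).
Proof.
move=> [_ _ ev]; rewrite nbhsE => [[V [opV Vx] VA]].
have [U [opU Ux] [S [_ SU Sev]]] := ev (p x).
have : (\bigcup_(W in S) W) x by rewrite SU.
move=> [W SW Wx].
have [opW _ _ Wop] := Sev W SW.
rewrite nbhsE; exists (p @` (V `&` W)).
  split; last by exists x.
  by apply: Wop; [exact: openI|move=> y []].
by move=> _ [y [Vy _] <-]; exists y => //; exact: VA.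
Qed.

End Coverings.

Section UniversalAbelian.
Context {R : realType} {M : topologicalType}.
Variables (M_compact : compact [set: M]) (dM : M -> M -> R).
Hypothesis dM_metric : compatible_metric dM.
Variable phi : R -> M -> M.
Variables (T : R) (E : universal_abelian_covering R M).
Hypothesis T_gt0 : 0 < T.
Variable dE : E -> E -> R.
Hypothesis dE_metric : covering_metric (@uac_proj R M E) dM dE.
Variable psi : R -> E -> E.
Hypothesis psi_lift : lifted_flow (@uac_proj R M E) phi psi.

Local Notation p := (@uac_proj R M E).
Local Notation act := (@uac_act R M E).

Lemma uac_deck a : deck_transformation p (act a).
Proof.
split; first exact: uac_act_continuous.
  by apply/funext => x; exact: uac_act_proj.
exists (act (- a)); split; first exact: uac_act_continuous.
  by move=> x; rewrite -uac_actD addNr uac_act0.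
by move=> x; rewrite -uac_actD subrr uac_act0.
Qed.

(** Freeness at scale [r] comes from injectivity of the projection on small balls, commutation with
    the flow from uniqueness of lifts, and [cs_near] from compactness of [M], the fibres being the
    orbits. *)
Lemma uac_cocompact : cocompact_system act psi dE T.
Proof.
case: (dE_metric) => dP isom [r r0 rP]; case: (psi_lift) => psiP psip.
split => //.
- exact: uac_act0.
- exact: uac_actD.
- by move=> a; apply: isom; exact: uac_deck.
- exists r => // a x xa; apply: (uac_act_free (x := x)); apply/esym/(metric_eq0 dP).
  rewrite -(rP x) // ?(metric_refl dP) //.
  by rewrite uac_act_proj (metric_refl dM_metric).
- move=> t a x.
  apply: (@lift_unique _ _ _ p dM dE dM_metric (fun t => psi t (act a x)) (fun t => act a
      (psi t x))) => //.
  + exact: flow_continuous_time.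
  + move=> s; apply: (@continuous_comp _ _ _ (psi^~ x) (act a));
      first exact: flow_continuous_time.
    exact: uac_act_continuous.
  + by move=> s; rewrite psip !uac_act_proj psip.
  + by rewrite !(flow0 _ psiP).
- move=> I F P FF Pact loc.
  have /compact_near_coveringP cov := M_compact.
  apply: (filterS _ (cov I F (fun i q => forall x, p x = q -> P i x) FF _)).
    by move=> i h x; exact: (h (p x)).
  move=> q _.
    have [_ psurj _] := uac_covering E.
    have [x _ xq] := psurj q Logic.I; rewrite -xq.
    have [[/= A B] [nA FB] AB] := loc x.
    exists (p @` A, B); first by split => //; exact: covering_nbhs (uac_covering E) nA.
    move=> [q' i] /= [[y Ay <-] Bi] z /esym yz.
    have [a ->] := uac_act_trans yz; apply: Pact.
    exact: (AB (y, i)).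
Qed.

Lemma class_fun_additive (al : H1R R M) : {morph al : a b / a + b}.
Proof. by case: al => f /= /asboolP. Qed.

(** * The quotient by the kernel of a class *)

Section Alpha.
Variable alpha : H1R R M.
Local Notation Ealpha := (alpha_covering E alpha).
Local Notation palpha := (@alpha_proj R M E alpha).
Variable dalpha : Ealpha -> Ealpha -> R.
Hypothesis dalpha_metric : covering_metric palpha dM dalpha.
Variable psialpha : R -> Ealpha -> Ealpha.
Hypothesis psialpha_lift : lifted_flow palpha phi psialpha.

Definition to_alpha (x : E) : Ealpha := \pi_(Ealpha)%qT x.

Lemma to_alphaP x y : to_alpha x = to_alpha y <-> exists2 a, alpha a = 0 & y = act a x.
Proof.
rewrite /to_alpha; split => [/eqmodP/asboolP //|h].
by apply/eqmodP/asboolP.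
Qed.

Lemma to_alpha_act a x : alpha a = 0 -> to_alpha (act a x) = to_alpha x.
Proof. by move=> a0; apply/esym/to_alphaP; exists a. Qed.

Lemma to_alpha_surj y : exists x, to_alpha x = y.
Proof. by exists (repr y); rewrite /to_alpha reprK. Qed.

Lemma to_alpha_continuous : continuous to_alpha.
Proof. exact: pi_continuous. Qed.

Lemma to_alpha_nbhs x A : nbhs x A -> nbhs (to_alpha x) (to_alpha @` A).
Proof.
rewrite nbhsE => [[V [opV Vx] VA]].
rewrite nbhsE; exists (to_alpha @` V); last by move=> _ [y Vy <-]; exists y => //;
    exact: VA.
split; last by exists x.
change (open (to_alpha @^-1` (to_alpha @` V))).
rewrite openE => y [z Vz zy]; have [a a0 ->] := (to_alphaP z y).1 zy.
rewrite /interior nbhsE; exists (act (- a) @^-1` V).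
  split; first by apply: open_comp => // w _; exact: uac_act_continuous.
  by rewrite /= -uac_actD addNr uac_act0.
move=> w /= Vw; exists (act (- a) w) => //; apply: to_alpha_act.
have alD := class_fun_additive alpha.
have al00 : alpha 0 = 0 by apply: (addrI (alpha 0)); rewrite -alD !addr0.
by apply: (addrI (alpha a)); rewrite -alD subrr al00 a0 addr0.
Qed.

Lemma alpha_proj_to_alpha x : palpha (to_alpha x) = p x.
Proof.
have [a _ xE] := (to_alphaP (repr (to_alpha x)) x).1 (reprK _).
by rewrite [in RHS]xE uac_act_proj.
Qed.

Lemma alpha_flow t x : psialpha t (to_alpha x) = to_alpha (psi t x).
Proof.
case: (dalpha_metric) => dP _ _; case: (psialpha_lift) => fP fp; case: (psi_lift) => gP gp.
apply: (@lift_unique _ _ _ palpha dM dalpha dM_metric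
  (fun t => psialpha t (to_alpha x)) (fun t => to_alpha (psi t x))) => //.
- exact: flow_continuous_time.
- move=> s; apply: (@continuous_comp _ _ _ (psi^~ x) to_alpha).
    exact: flow_continuous_time.
  exact: to_alpha_continuous.
- by move=> s; rewrite fp !alpha_proj_to_alpha gp.
- by rewrite !(flow0 psialpha) ?(flow0 psi).
Qed.

(** [act a] descends because [H_1] is commutative. The shifts are deck transformations, hence
    isometries of [dalpha], so local comparisons of [dE] with [dalpha] become uniform. *)
Definition alpha_shift a (y : Ealpha) : Ealpha := to_alpha (act a (repr y)).

Lemma alpha_shiftE a x : alpha_shift a (to_alpha x) = to_alpha (act a x).
Proof.
have [b b0 xE] := (to_alphaP (repr (to_alpha x)) x).1 (reprK _).
rewrite [in RHS]xE /alpha_shift -uac_actD addrC uac_actD.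
by rewrite [RHS]to_alpha_act.
Qed.

Lemma alpha_shiftK a : cancel (alpha_shift a) (alpha_shift (- a)).
Proof.
move=> y; have [x <-] := to_alpha_surj y.
by rewrite !alpha_shiftE -uac_actD addNr uac_act0.
Qed.

Lemma alpha_shift_continuous a : continuous (alpha_shift a).
Proof.
apply/quotient_continuous => x.
have -> : alpha_shift a \o \pi_Ealpha%qT = to_alpha \o act a.
  by apply/funext => y /=; rewrite -alpha_shiftE.
by apply: continuous_comp; [exact: uac_act_continuous|exact: to_alpha_continuous].
Qed.

Lemma alpha_shift_isom a x y : dalpha (alpha_shift a x) (alpha_shift a y) = dalpha x y.
Proof.
case: dalpha_metric => _ isom _; apply: isom; split.
- exact: alpha_shift_continuous.
- apply/funext => z /=; have [w <-] := to_alpha_surj z.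
  by rewrite alpha_shiftE !alpha_proj_to_alpha uac_act_proj.
exists (alpha_shift (- a)); split; first exact: alpha_shift_continuous.
  exact: alpha_shiftK.
by rewrite -{2}[a]opprK; exact: alpha_shiftK.
Qed.

Lemma to_alpha_uniform eps : 0 < eps -> exists2 h, 0 < h &
  forall x y, dE x y < h -> dalpha (to_alpha x) (to_alpha y) < eps.
Proof.
move=> eps0; case: (dalpha_metric) => dP _ _; case: (dE_metric) => dEP _ _.
apply: (cocompact_eps uac_cocompact (fun h x => forall y, dE x y < h ->
  dalpha (to_alpha x) (to_alpha y) < eps)).
  move=> a h x xP y; rewrite (isomK uac_cocompact) => /xP.
  by rewrite -(alpha_shift_isom a) !alpha_shiftE (actNK uac_cocompact).
move=> x; have e2 : 0 < eps / 2 by lra.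
have := to_alpha_continuous x _ (nbhs_metric dP (to_alpha x) _ e2).
move=> /(nbhs_metricP dEP)[e e0 eP]; exists (e / 2); first by lra.
move=> y h xy he z yz; have xz := metric_triangle dEP y x z.
have h1 := eP y ltac:(rewrite /=; lra); have h2 := eP z ltac:(rewrite /=; lra).
have := metric_triangle dP (to_alpha x) (to_alpha y) (to_alpha z).
by rewrite (metric_sym dP (to_alpha y) (to_alpha x)); move: h1 h2 => /=; lra.
Qed.

Lemma to_alpha_lift_uniform eps : 0 < eps -> exists2 h, 0 < h &
  forall x y, dalpha (to_alpha x) y < h -> exists2 z, to_alpha z = y & dE x z < eps.
Proof.
move=> eps0; case: (dalpha_metric) => dP _ _; case: (dE_metric) => dEP _ _.
apply: (cocompact_eps uac_cocompact (fun h x => forall y, dalpha (to_alpha x) y < h ->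
  exists2 z, to_alpha z = y & dE x z < eps)).
  move=> a h x xP y; rewrite -alpha_shiftE -(alpha_shift_isom (- a)) alpha_shiftK.
  move=> /xP[z zy xz]; exists (act a z); last by rewrite (cs_isom _ _ _ _ uac_cocompact).
  by rewrite -alpha_shiftE zy -{1}[a]opprK alpha_shiftK.
move=> x; have e2 : 0 < eps / 2 by lra.
have := to_alpha_nbhs x _ (nbhs_metric dEP x _ e2).
move=> /(nbhs_metricP dP)[r r0 rP]; have r2 : 0 < r / 2 by lra.
have [e e0 eP] := to_alpha_uniform _ r2.
exists (Num.min (Num.min e (eps / 2)) (r / 2)); first by rewrite !lt_min e0 e2.
move=> x' h; rewrite !lt_min => /andP[/andP[xe xeps] xr] /andP[h0 /andP[_ hr]] y x'y.
have [|z /= xz zy] := rP y.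
  by have := metric_triangle dP (to_alpha x') (to_alpha x) y; have := eP _ _ xe;
      rewrite /=; lra.
exists z => //; have := metric_triangle dEP x x' z.
by rewrite (metric_sym dEP x' x); lra.
Qed.

Lemma chain_lift eps h : (forall x y, dalpha (to_alpha x) y < h ->
    exists2 z, to_alpha z = y & dE x z < eps) ->
  forall x y, chain psialpha dalpha T h (to_alpha x) y ->
    exists2 z, to_alpha z = y & chain psi dE T eps x z.
Proof.
move=> hP x y; elim=> [|u v _ [z zu xz] [tau Tt uv]]; first by exists x => //;
    exact: rtc_refl.
have [|w wv zw] := hP (psi tau z) v; first by rewrite -alpha_flow zu.
by exists w => //; apply: rtc_rcons xz _; exists tau.
Qed.

(** Points with the same image in the quotient differ by an element of the kernel, so a closed
    pseudo-orbit lifts, jump by jump, to a return of null class; [null_recurrent_flowed] matches the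
    final segments. *)
Lemma alpha_recurrentE : alpha_recurrent psialpha dalpha T =
  p @` null_recurrent (act := act) (psi := psi) (d := dE) (T := T) alpha.
Proof.
have alD := class_fun_additive alpha.
have [dP _ _] := dalpha_metric; have [fP _] := psialpha_lift.
apply/seteqP; split=> _ [y ry <-].
  have [x xy] := to_alpha_surj y; exists x; last by rewrite -alpha_proj_to_alpha xy.
  apply/(null_recurrent_flowed uac_cocompact _ _ alD) => eps eps0.
  have [h h0 hP] := to_alpha_lift_uniform _ eps0.
  have [l [gam [po g0 gl]]] := ry _ h0.
  have [_ /(_ _ gl)[y1 [tau [yy1 tau0 yE]]]] :=
      pseudo_orbit_chain psialpha dalpha T T_gt0 dP fP _ _ _ po.
  rewrite g0 -xy in yy1; have [z zy1 xz] := chain_lift _ _ hP _ _ yy1.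
  have := yE; rewrite -zy1 alpha_flow -xy => /to_alphaP[a a0 ax].
  by exists a, z, tau.
exists (to_alpha y); last exact: alpha_proj_to_alpha.
move=> eps eps0; have [h h0 hP] := to_alpha_uniform _ eps0.
have [a [z [tau [a0 yz tau0 zE]]]] :=
    (null_recurrent_flowed uac_cocompact _ _ alD).1 ry h h0.
have yz' : chain psialpha dalpha T eps (to_alpha y) (to_alpha z).
  apply: rtc_map yz => u v [s Ts uv]; exists s => //.
  by rewrite alpha_flow; exact: hP.
have [l [gam [po g0 gl _]]]
    := chain_pseudo_orbit psialpha dalpha T T_gt0 dP fP _ _ _ _ yz' tau0.
exists l, gam; split => //.
by move: gl; rewrite alpha_flow zE to_alpha_act.
Qed.

Lemma null_recurrent_image_compact : compact (p @` null_recurrent (act := act) (psi :=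
    psi) (d := dE) (T := T) alpha).
Proof.
apply: (subclosed_compact _ M_compact) => //; rewrite -openC openE => q nrq.
have [_ psurj _] := uac_covering E; have [x _ xq] := psurj q Logic.I.
have nrx : ~ null_recurrent (act := act) (psi := psi) (d := dE) (T := T) alpha x.
  by move=> rx; apply: nrq; exists x.
have [e e0 eP] := not_null_recurrent_near uac_cocompact _ _ nrx.
case: (dE_metric) => dEP _ _.
have := covering_nbhs (uac_proj (u := E)) x _ (uac_covering E) (nbhs_metric dEP x e e0).
rewrite /interior xq; apply: filterS => _ [y /= xy <-] [z rz zy].
have [a yE] := uac_act_trans zy.
have ry := null_recurrent_act uac_cocompact _ a _ rz; rewrite -yE in ry.
have e2 : 0 < e / 2 by lra.
have [b b0 yb] := ry _ e2.
by apply: (eP y (e / 2) xy _ b b0 yb); lra.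
Qed.

Lemma null_recurrent_image_invariant t :
  phi t @` (p @` null_recurrent (act := act) (psi := psi) (d := dE) (T := T) alpha) =
  p @` null_recurrent (act := act) (psi := psi) (d := dE) (T := T) alpha.
Proof.
have [fP fp] := psi_lift.
apply/seteqP; split=> [_ [_ [x rx <-] <-]|_ [x rx <-]].
  by exists (psi t x); [exact: (null_recurrent_flow uac_cocompact)|rewrite fp].
exists (p (psi (- t) x)); first by exists (psi (- t) x) => //;
    exact: (null_recurrent_flow uac_cocompact).
by rewrite -fp -(flowD _ fP) subrr (flow0 _ fP).
Qed.

End Alpha.
End UniversalAbelian.

(** The elements that bring one net point within [r / 2] of another generate [H]. The balls of
    radius [r / 4] around translates of the net by elements satisfying [P], and those by all other
    elements, form two disjoint open sets covering [X]; connectedness leaves only the first. *)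
Lemma finitely_generated {R : realType} {X : topologicalType} {H : zmodType}
    {act : H -> X -> X} {psi : R -> X -> X} {d : X -> X -> R} {T : R}
    (x0 : X) : cocompact_system act psi d T -> connected [set: X] ->
  exists s : seq H, forall P : H -> Prop, P 0 ->
    (forall g a, g \in s -> P a -> P (a + g)) ->
    (forall g a, g \in s -> P (a + g) -> P a) -> forall a, P a.
Proof.
move=> cs Xc; have dP := cs_metric _ _ _ _ cs; have isom := cs_isom _ _ _ _ cs.
have act0 := cs_act0 _ _ _ _ cs; have actD := cs_actD _ _ _ _ cs.
case: (cs_free _ _ _ _ cs) => r r0 free.
have e0 : 0 < r / 4 by lra.
have [n [p net]] := finite_net cs _ e0.
pose F (ij : 'I_n * 'I_n) := xget 0 [set a | d (p ij.1) (act a (p ij.2)) < r / 2].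
have FE i j a : d (p i) (act a (p j)) < r / 2 -> F (i, j) = a.
  move=> ija; have ijF : d (p i) (act (F (i, j)) (p j)) < r / 2.
    exact: (@xgetPex _ 0 [set a | d (p i) (act a (p j)) < r / 2]) (ex_intro _ a ija).
  apply/eqP; rewrite eq_sym -subr_eq0; apply/eqP/(free _ (act (F (i, j)) (p j))).
  rewrite -actD subrK; have := metric_triangle dP (p i) (act (F (i, j)) (p j)) (act a
      (p j)).
  by rewrite (metric_sym dP _ (p i)); lra.
exists (codom F) => P P0 Padd Psub.
have close a b i j : d (act a (p i)) (act b (p j)) < r / 2 ->
    exists2 g, g \in codom F & b = a + g.
  move=> ab; exists (b - a); last by rewrite addrC subrK.
  have <- : F (i, j) = b - a; last exact: codom_f.
  by apply: FE; move: ab; rewrite (isomK cs) -actD addrC.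
pose V := [set x | exists a i, P a /\ d x (act a (p i)) < r / 4].
have nearD (Q : H -> Prop) : open [set x | exists a i, Q a /\ d x (act a (p i)) < r / 4].
  rewrite openE => x [a [i [Qa xa]]]; rewrite /interior.
  have q0 : 0 < r / 4 - d x (act a (p i)) by lra.
  have := nbhs_metric dP x _ q0; apply: filterS => y /= xy; exists a, i; split => //.
  by have := metric_triangle dP x y (act a (p i)); rewrite (metric_sym dP y x); lra.
have VT : V = [set: X].
  apply: Xc.
  - have [i [a xa]] := net x0; exists (act (- a) x0), 0, i; split => //.
    by rewrite (isomK cs) opprK -actD addr0.
  - by exists V; [exact: nearD|rewrite setTI].
  - exists V; last by rewrite setTI.
    rewrite -openC (_ : ~` V = [set x | exists a i, ~ P a /\ d x (act a (p i)) < r / 4]).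
      exact: nearD.
    apply/seteqP; split=> x.
      move=> nVx; have [i [a xa]] := net x; exists a, i; split => // Pa.
      by apply: nVx; exists a, i.
    move=> [a [i [nPa xa]]] [b [j [Pb xb]]]; apply: nPa.
    have [g gF ->] : exists2 g, g \in codom F & a = b + g.
      apply: (close b a j i); have := metric_triangle dP x (act b (p j)) (act a (p i)).
      by rewrite (metric_sym dP _ x); lra.
    exact: Padd.
move=> b; have [i _] := net x0.
have [a [j [Pa ba]]] : V (act b (p i)) by rewrite VT.
have [|g gF ->] := close a b j i; first by rewrite (metric_sym dP); lra.
exact: Padd.
Qed.

(** * Faces of cones of cohomology classes *)

Section Evaluation.
Context {R : realType} {M : topologicalType}.
Local Notation V := (H1R R M).
Implicit Types (u v : V) (a : H1Z R M).

Lemma H1R_ext u v : (forall a, u a = v a) -> u = v.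
Proof. by move=> uv; apply: val_inj; apply/funext. Qed.

Lemma H1R_addE u v a : (u + v) a = u a + v a. Proof. by []. Qed.
Lemma H1R_oppE u a : (- u) a = - u a. Proof. by []. Qed.
Lemma H1R_scaleE k u a : (k *: u) a = k * u a. Proof. by []. Qed.
Definition H1R_E := (H1R_addE, H1R_oppE, H1R_scaleE).

Lemma scale_sum n (k : R) (c : 'I_n -> R) (v : 'I_n -> V) :
  \sum_i (k * c i) *: v i = k *: \sum_i c i *: v i.
Proof. by rewrite scaler_sumr; apply: eq_bigr => i _; rewrite scalerA. Qed.

Lemma H1R_sumE n (c : 'I_n -> R) (v : 'I_n -> V) a :
  (\sum_i c i *: v i) a = \sum_i c i * v i a.
Proof.
elim: n c v => [|n IH] c v; first by rewrite !big_ord0.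
by rewrite !big_ord_recl -IH.
Qed.

Lemma eval_continuous a : continuous (fun u => u a).
Proof.
have h : continuous (@class_fun R M : V -> {ptws H1Z R M ->
    R}) by exact: initial_continuous.
move=> u A /(@proj_continuous _ (fun=> R : topologicalType) a) nA.
exact: h nA.
Qed.

Lemma line_continuous u v : continuous (fun t : R => u + t *: v).
Proof.
apply: continuous_comp_initial => t.
apply/cvg_sup => b U [? /= [[W opW <-]]] /= Wb /filterS; apply; first exact: fmap_filter.
have c : (fun s : R => u b + s * v b) s @[s --> t] --> u b + t * v b.
  by apply: cvgD; [exact: cvg_cst|apply: cvgMl; exact: cvg_id].
exact: c _ (open_nbhs_nbhs (conj opW Wb)).
Qed.

(* Induction on the separating family [s]: if [w] in [S] takes the value [1] at
   the first element [h], subtracting [u h *: w] from [u] reduces to the subspace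
   of [S] that vanishes at [h]. *)
Lemma evaluation_basis (s : seq (H1Z R M)) (S : set V) :
  S 0 -> (forall k u v, S u -> S v -> S (k *: u + v)) ->
  (forall u, S u -> (forall g, g \in s -> u g = 0) -> u = 0) ->
  exists n (g : 'I_n -> H1Z R M) (v : 'I_n -> V), (forall i, S (v i)) /\
    forall u, S u -> u = \sum_i u (g i) *: v i.
Proof.
elim: s S => [|h s IH] S S0 Slin sep.
  exists 0%N, (fun=> 0), (fun=> 0); split=> [[]//|u Su].
  by rewrite big_ord0; apply: sep.
have [|||n [g [v [Sv uE]]]] := IH [set u | S u /\ u h = 0].
- by [].
- move=> k u v [Su u0] [Sv v0]; split; first exact: Slin.
  by change (k * u h + v h = 0); rewrite u0 v0 mulr0 addr0.
- by move=> u [Su uh] us; apply: sep => // b; rewrite inE => /predU1P[->//|]; exact: us.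
have Sscale k u : S u -> S (k *: u).
  by move=> Su; rewrite -[k *: u]addr0; exact: Slin.
have Sadd u w : S u -> S w -> S (u + w).
  by move=> Su Sw; rewrite -[u]scale1r; exact: Slin.
have Ssum (c : 'I_n -> R) : S (\sum_i c i *: v i).
  apply: (big_ind S) => // i _; apply: Sscale; exact: (Sv i).1.
have [[w0 Sw0 /eqP w0h]|noW] := pselect (exists2 w, S w & w h <> 0); last first.
  exists n, g, v; split=> [i|u Su]; first exact: (Sv i).1.
  apply: uE; split => //; apply: contrapT => uh; apply: noW; by exists u.
pose w := (w0 h)^-1 *: w0.
have wh : w h = 1 by change ((w0 h)^-1 * w0 h = 1); rewrite mulVf.
have Sw : S w by exact: Sscale.
pose v0 := w + (-1) *: \sum_i w (g i) *: v i.
exists n.+1, (fun i => oapp g h (unlift ord0 i)), (fun i => oapp v v0 (unlift ord0 i)).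
split=> [i|u Su].
  case: unliftP => [j _|_] /=; first exact: (Sv j).1.
  by apply: Sadd => //; apply: Sscale; exact: Ssum.
rewrite big_ord_recl unlift_none /=.
under eq_bigr do rewrite liftK /=.
have := uE (u + (- u h) *: w) _; move=> E; have {E} := E _.
have Su' : S (u + (- u h) *: w) by apply: Sadd => //; exact: Sscale.
have u'h : (u + (- u h) *: w) h = 0 by change (u h + (- u h) * w h = 0);
    rewrite wh mulr1 subrr.
move=> /(_ (conj Su' u'h)) E.
apply: H1R_ext => a; have := congr1 (fun f : V => f a) E.
rewrite H1R_sumE => Ea.
change (u a = u h * (w a + (-1) * (\sum_i w (g i) *: v i) a) + (\sum_i u (g i) *: v i) a).
rewrite !H1R_sumE mulN1r mulrBr mulr_sumr.
have -> : u a = - ((- u h) * w a) + (\sum_i (u + - u h *: w) (g i) * v i a).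
  by rewrite -Ea; change (u a = - (- u h * w a) + (u a + - u h * w a)); rewrite addrC addrK.
rewrite mulNr opprK -addrA; congr (_ + _).
rewrite -sumrN -big_split /=; apply: eq_bigr => i _.
change ((u (g i) + - u h * w (g i)) * v i a = - (u h * (w (g i) * v i a)) + u
    (g i) * v i a).
by rewrite mulrDl addrC !mulNr mulrA.
Qed.

End Evaluation.

Section SpanFaces.
Context {R : realType} {M : topologicalType}.
Local Notation V := (H1R R M).
Implicit Types (F Q : set V) (x y al be : V).

Lemma span_lin F k x y : linear_span F x -> linear_span F y -> linear_span F (k *: x + y).
Proof.
move=> [n [a [e [Fe ->]]]] [m [b [f [Ff ->]]]].
exists (n + m)%N, (fun i
    : 'I_(n + m) => match fintype.split i with inl j => k * a j | inr j => b j end),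
  (fun i : 'I_(n + m) => match fintype.split i with inl j => e j | inr j => f j end); split.
  by move=> i; case: fintype.split.
rewrite big_split_ord /= scaler_sumr; congr (_ + _); apply: eq_bigr => i _.
  by rewrite (unsplitK (inl i)) scalerA.
by rewrite (unsplitK (inr i)).
Qed.

Lemma sub_span F x : F x -> linear_span F x.
Proof. by move=> Fx; exists 1%N, (fun=> 1), (fun=> x); rewrite big_ord1 scale1r. Qed.

Lemma span0 F : linear_span F 0.
Proof. by exists 0%N, (fun=> 0), (fun=> 0); split=> [[]//|]; rewrite big_ord0. Qed.

Lemma span_scale F k x : linear_span F x -> linear_span F (k *: x).
Proof. by move=> Fx; rewrite -[k *: x]addr0; apply: span_lin => //; exact: span0. Qed.

Lemma span_add F x y : linear_span F x -> linear_span F y -> linear_span F (x + y).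
Proof. by move=> Fx Fy; rewrite -[x]scale1r; exact: span_lin. Qed.

Lemma open_span_line F x v : open_in_span F -> F x -> linear_span F v ->
  \forall t \near (0 : R), F (x + t *: v).
Proof.
move=> [U oU FE] Fx Fv; have Ux : U (x + 0 *: v).
  by move: Fx; rewrite scale0r addr0 FE => -[].
have Ut : \forall t \near (0 : R), U (x + t *: v).
  exact: (line_continuous x v 0 _ (open_nbhs_nbhs (conj oU Ux))).
apply: filterS Ut => t Ut; rewrite FE; split => //.
by apply: span_add; [exact: sub_span|exact: span_scale].
Qed.

Lemma span_mono F (S : set V) : S 0 -> (forall k x y, S x -> S y -> S (k *: x + y)) ->
  F `<=` S -> linear_span F `<=` S.
Proof.
move=> S0 Slin FS _ [n [a [e [Fe ->]]]].
apply: (big_ind S) => // [x y Sx Sy|i _]; first by rewrite -[x]scale1r; exact: Slin.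
by rewrite -[a i *: _]addr0; apply: Slin => //; exact: FS.
Qed.

Variable s : seq (H1Z R M).
Hypothesis sep : forall u : V, (forall g, g \in s -> u g = 0) -> u = 0.

(** On the span, [u a] is for every [a] a fixed linear combination of the values [u (g i)].
    Evaluations being continuous, these identities persist in the closure and express a limit
    through the [v i]. *)
Lemma closure_span F : closure F `<=` linear_span F.
Proof.
move=> al clal.
have [n [g [v [Fv uE]]]] := evaluation_basis s (linear_span F) (span0 F)
  (@span_lin F) (fun u _ => sep u).
have -> : al = \sum_i al (g i) *: v i; last first.
  by apply: (big_ind (linear_span F)) => [|x y|i _];
    [exact: span0|exact: span_add|exact: span_scale].
apply: H1R_ext => a; rewrite H1R_sumE; apply: contrapT => /eqP; rewrite -subr_eq0 => ne.
pose h (u : V) := u a - \sum_i u (g i) * v i a.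
have hc : continuous h.
  have sc : continuous (fun u : V => \sum_i u (g i) * v i a).
    apply: continuous_big => [|i _ w]; first exact: add_continuous.
    by apply: (@cvgMl _ _ (nbhs w)); exact: (eval_continuous (g i) w).
  by move=> u; apply: (@cvgB _ _ _ (nbhs u)); [exact: (eval_continuous a u)|exact: (sc u)].
have nh : 0 < `|h al| by rewrite normr_gt0.
have [u [Fu /= hu]] := clal _ (hc al _ (nbhsx_ballx (h al) _ nh)).
have hu0 : h u = 0.
  by rewrite /h {1}(uE u (sub_span _ _ Fu)) H1R_sumE subrr.
by move: hu; rewrite /ball /= hu0 subr0 ltxx.
Qed.

Variable Q : set V.
Hypothesis Qadd : forall x y, Q x -> Q y -> Q (x + y).
Hypothesis Qscale : forall (k : R) x, 0 <= k -> Q x -> Q (k *: x).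

(* The candidate for the open face through [be]: the points of the relative
   interior of the smallest face of [Q] containing [be]. *)
Definition relint be : set V :=
  [set x | exists s : R, [/\ 0 < s, Q (be - s *: x) & Q (x - s *: be)]].

Lemma shrinkl be x (k l : R) : Q be -> 0 <= l <= k -> Q (be - k *: x) -> Q (be - l *: x).
Proof.
move=> Qbe /andP[l0 lk] Qx.
have [k0|k0] := leP k 0.
  have -> : l = k by apply/eqP; rewrite eq_le lk; lra.
  by [].
have lk1 : 0 <= 1 - l / k by rewrite subr_ge0 ler_pdivrMr // mul1r.
have -> : be - l *: x = (l / k) *: (be - k *: x) + (1 - l / k) *: be.
  by apply: H1R_ext => a; rewrite !H1R_E; field; rewrite gt_eqF.
by apply: Qadd; apply: Qscale => //; apply: divr_ge0 => //; exact: ltW.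
Qed.

Lemma shrinkr be x (k l : R) : Q be -> l <= k -> Q (x - k *: be) -> Q (x - l *: be).
Proof.
move=> Qbe lk Qx; have -> : x - l *: be = (x - k *: be) + (k - l) *: be.
  by rewrite scalerBl addrA subrK.
by apply: Qadd => //; apply: Qscale => //; rewrite subr_ge0.
Qed.

Lemma relint_intro be x (k l : R) : Q be -> 0 < k -> 0 < l -> Q (be - k *: x) ->
  Q (x - l *: be) -> relint be x.
Proof.
move=> Qbe k0 l0 Qk Ql; exists (Num.min k l); split; first by rewrite lt_min k0.
  by apply: (shrinkl _ _ k) => //; rewrite ge_min lexx le_min (ltW k0) (ltW l0).
by apply: (shrinkr _ _ l) => //; rewrite ge_min lexx orbT.
Qed.

Lemma relint_sub be : Q be -> relint be `<=` Q.
Proof.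
move=> Qbe x [k [k0 _ Qx]]; rewrite -[x](subrK (k *: be)).
by apply: Qadd => //; apply: Qscale => //; exact: ltW.
Qed.

Lemma relint_add be x y : Q be -> relint be x -> relint be y -> relint be (x + y).
Proof.
move=> Qbe [k [k0 Qk Qk']] [l [l0 Ql Ql']].
pose m := Num.min k l.
have m0 : 0 < m by rewrite lt_min k0.
have mk : m <= k by rewrite ge_min lexx.
have ml : m <= l by rewrite ge_min lexx orbT.
apply: (relint_intro _ _ (m / 2) m) => //; first by lra.
- have -> : be - (m / 2) *: (x + y) = (1 / 2) *: (be - m *: x) + (1 / 2) *: (be - m *: y).
    by apply: H1R_ext => a; rewrite !H1R_E; field.
  apply: Qadd; apply: Qscale; try lra.
    by apply: (shrinkl _ _ k) => //; rewrite (ltW m0).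
  by apply: (shrinkl _ _ l) => //; rewrite (ltW m0).
- apply: (shrinkr _ _ (k + l)) => //; first by lra.
  by rewrite scalerDl opprD addrACA; exact: Qadd.
Qed.

Lemma relint_scale be x (a : R) : Q be -> 0 < a -> relint be x -> relint be (a *: x).
Proof.
move=> Qbe a0 [k [k0 Qk Qk']].
apply: (relint_intro _ _ (k / a) (a * k)) => //.
- exact: divr_gt0.
- exact: mulr_gt0.
- by rewrite scalerA divfK ?gt_eqF.
- by rewrite -scalerA -scalerBr; apply: Qscale => //; exact: ltW.
Qed.

(** The directions in which [be] can be moved both ways inside [Q] form a linear subspace, [Q] being
    a convex cone, and it contains [relint be]. *)
Lemma relint_span_small be v : Q be -> linear_span (relint be) v ->
  exists2 k : R, 0 < k & forall t, `|t| <= k -> Q (be + t *: v).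
Proof.
move=> Qbe; move: v; apply: span_mono.
- by exists 1 => // t _; rewrite scaler0 addr0.
- move=> a x y [k k0 xP] [l l0 yP]; pose m := 2 * (`|a| + 1).
  have m0 : 0 < m by rewrite /m; have := normr_ge0 a; lra.
  exists (Num.min (k / m) (l / 2)); first by rewrite lt_min !divr_gt0.
  move=> t; rewrite le_min => /andP[tk tl].
  have -> : be + t *: (a *: x + y) =
      (1 / 2) *: (be + (2 * t * a) *: x) + (1 / 2) *: (be + (2 * t) *: y).
    by apply: H1R_ext => b; rewrite !H1R_E; field.
  apply: Qadd; apply: Qscale; try lra; [apply: xP|apply: yP].
    rewrite normrM normrM ger0_norm //.
    have : `|t| * m <= k by rewrite -ler_pdivlMr.
    by rewrite /m; have := normr_ge0 a; have := normr_ge0 t; nra.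
  by rewrite normrM ger0_norm //; lra.
- move=> x rx; have [k [k0 Qk Qk']] := rx; have Qx := relint_sub _ Qbe _ rx.
  exists k => // t; rewrite ler_norml => /andP[kt tk].
  have [t0|t0] := leP 0 t; first by apply: Qadd => //; exact: Qscale.
  rewrite -[t]opprK scaleNr; apply: (shrinkl _ _ k) => //; lra.
Qed.

Lemma relint_span_ball be n (v : 'I_n -> V) : Q be ->
  (forall i, linear_span (relint be) (v i)) ->
  exists2 k : R, 0 < k & forall c : 'I_n -> R, (forall i, `|c i| <= k) ->
    Q (be + \sum_i c i *: v i).
Proof.
move=> Qbe; elim: n v => [|n IH] v Sv.
  by exists 1 => // c _; rewrite big_ord0 addr0.
have [k k0 kP] := IH (fun i => v (lift ord0 i)) (fun i => Sv _).
have [l l0 lP] := relint_span_small _ _ Qbe (Sv ord0).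
exists (Num.min (k / 2) (l / 2)); first by rewrite lt_min !divr_gt0.
move=> c ck.
have -> : be + \sum_i c i *: v i = (1 / 2) *: (be + (2 * c ord0) *: v ord0) +
    (1 / 2) *: (be + \sum_i (2 * c (lift ord0 i)) *: v (lift ord0 i)).
  by rewrite scale_sum big_ord_recl; apply: H1R_ext => b; rewrite !H1R_E; field.
apply: Qadd; apply: Qscale; try lra.
  apply: lP; have := ck ord0; rewrite le_min normrM ger0_norm // => /andP[_].
  by lra.
apply: kP => i; have := ck (lift ord0 i); rewrite le_min normrM ger0_norm // => /andP[+ _].
by lra.
Qed.

(** A small change of [x] within the span, measured in the coordinates [g i], is absorbed by the
    room around [be] at the price of halving the constant [l]. *)
Lemma relint_open be : Q be -> open_in_span (relint be).
Proof.
move=> Qbe; set G := relint be.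
have [n [g [v [Gv uE]]]] := evaluation_basis s (linear_span G) (span0 G)
  (@span_lin G) (fun u _ => sep u).
have [k k0 kP] := relint_span_ball _ _ _ Qbe Gv.
pose W := [set x | linear_span G x -> G x].
have GW : G `<=` W°.
  move=> x Gx; have [l [l0 Ql Ql']] := Gx.
  (* [k / l] suits [be - (l / 2) *: y], where the coordinates of [y - x] get the factor [- l];
     [k * l / 2] suits [y - (l / 2) *: be], where the factor is [2 / l]. *)
  pose m := Num.min (k * l / 2) (k / l).
  have m0 : 0 < m by rewrite lt_min !divr_gt0 // mulr_gt0.
  have mk1 : m <= k * l / 2 by rewrite ge_min lexx.
  have mk2 : m <= k / l by rewrite ge_min lexx orbT.
  have near i : nbhs x (fun y : V => `|x (g i) - y (g i)| < m).
    exact: (eval_continuous (g i) x _ (nbhsx_ballx (x (g i)) _ m0)).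
  have : nbhs x (fun y : V => forall i, `|x (g i) - y (g i)| < m) by exact:
      (@filter_forall V 'I_n _ (nbhs x) (nbhs_filter x) near).
  apply: filterS => y ym Sy.
  have yxE : y - x = \sum_i (y - x) (g i) *: v i.
    by apply: uE; rewrite addrC -scaleN1r; apply: span_lin => //; exact: sub_span.
  have yxb i : `|(y - x) (g i)| <= m by rewrite !H1R_E distrC; exact: ltW.
  apply: (relint_intro _ _ (l / 2) (l / 2)) => //; try by lra.
  - have -> : be - (l / 2) *: y = (1 / 2) *: (be - l *: x) +
        (1 / 2) *: (be + \sum_i (- l * (y - x) (g i)) *: v i).
      by rewrite scale_sum -yxE; apply: H1R_ext => b; rewrite !H1R_E; field.
    apply: Qadd; apply: Qscale; try lra; first by [].
    apply: kP => i; rewrite normrM normrN (gtr0_norm l0).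
    by apply: le_trans (ler_wpM2l (ltW l0) (yxb i)) _; rewrite mulrC -ler_pdivlMr.
  - have -> : y - (l / 2) *: be = (x - l *: be) +
        (l / 2) *: (be + \sum_i (2 / l * (y - x) (g i)) *: v i).
      by rewrite scale_sum -yxE; apply: H1R_ext => b; rewrite !H1R_E; field; rewrite gt_eqF.
    apply: Qadd => //; apply: Qscale; first by lra.
    apply: kP => i; rewrite normrM gtr0_norm ?divr_gt0 //.
    by rewrite mulrAC ler_pdivrMr //; have := yxb i; lra.
exists W°; first exact: open_interior.
apply/seteqP; split=> [x Gx|x [/interior_subset Wx Sx]]; last exact: Wx.
by split; [exact: GW|exact: sub_span].
Qed.

(** [relint be] is an open subcone, so by maximality it suffices that it contains [F]: openness of
    [F] in its span allows a small multiple of [x] to be subtracted from [be], and of [be] from [x],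
    inside [F]. *)
Lemma open_face_relint F be : open_face Q F -> F be -> F = relint be.
Proof.
move=> [[_ FQ [_ _] Fopen] Fmax] Fbe; have Qbe := FQ _ Fbe.
apply/esym/Fmax.
- split; last exact: relint_open.
  + exists be; apply: (relint_intro _ _ (1 / 2) (1 / 2)) => //; try lra.
      rewrite -{1}[be]scale1r -scalerBl; apply: Qscale => //; lra.
    rewrite -{1}[be]scale1r -scalerBl; apply: Qscale => //; lra.
  + exact: relint_sub.
  + split; last by move=> a x a0; exact: relint_scale.
    apply/convex_setW => x y /set_mem rx /set_mem ry k k0 k1; apply/mem_set.
    apply: relint_add => //; apply: relint_scale => //.
    by rewrite subr_gt0.
- move=> x Fx.
  have n1 := open_span_line _ _ _ Fopen Fbe (sub_span _ _ Fx).
  have n2 := open_span_line _ _ _ Fopen Fx (sub_span _ _ Fbe).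
  have [e /= e0 eP] := filterI n1 n2.
  have e2 : ball (0 : R) e (- (e / 2)).
    by rewrite /ball /= sub0r opprK gtr0_norm; lra.
  have [h1 h2] := eP _ e2; rewrite !scaleNr in h1 h2.
  by exists (e / 2); split; [lra|exact: FQ|exact: FQ].
Qed.

End SpanFaces.

(** * Comparison of faces through their recurrent sets *)

Section Assembly.
Context {R : realType} {M : topologicalType}.
Local Notation V := (H1R R M).
Variables (Q : set V) (Ral : V -> set M) (phi : R -> M -> M).
Hypothesis Qadd : forall x y, Q x -> Q y -> Q (x + y).
Hypothesis Qscale : forall (k : R) x, 0 <= k -> Q x -> Q (k *: x).
Hypothesis faceE : forall F be, open_face Q F -> F be -> F = relint Q be.
Hypothesis face_closed : forall F, open_face Q F -> closure F `<=` linear_span F.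
Hypothesis Ral_sub : forall al be, Q al -> Q be ->
  (Ral be `<=` Ral al <-> exists2 s : R, 0 < s & Q (be - s *: al)).

(** If [al] is in the closure of [F2] it is in its span, and openness keeps [be - s *: al] in [F2]
    for small [s]. Conversely, [x + t *: be] lies in [relint be] for [t > 0] and tends to [x] as [t]
    tends to [0]. *)
Lemma face_le F1 F2 al be : open_face Q F1 -> open_face Q F2 -> F1 al -> F2 be ->
  (F1 `<=` closure F2 <-> Ral be `<=` Ral al).
Proof.
move=> fF1 fF2 F1al F2be; have Qal : Q al by case: fF1 => [[_ + _ _] _]; exact.
have Qbe : Q be by case: fF2 => [[_ + _ _] _]; exact.
split=> [F12|/(Ral_sub _ _ Qal Qbe)[s s0 Qs] x F1x].
  apply/Ral_sub => //; case: (fF2) => [[_ FQ _ Fopen] _].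
  have near := open_span_line _ _ _ Fopen F2be (face_closed _ fF2 _ (F12 _ F1al)).
  have [e /= e0 eP] := near; exists (e / 2); first by lra.
  rewrite -scaleNr; apply: FQ; apply: eP.
  by rewrite /ball /= sub0r opprK gtr0_norm; lra.
have Qx : Q x by case: fF1 => [[_ + _ _] _]; exact.
have [k k0 Qk] : exists2 k : R, 0 < k & Q (be - k *: x).
  have [l [l0 Qlx _]] : relint Q al x by rewrite -(faceE _ _ fF1 F1al).
  exists (s * l); first exact: mulr_gt0.
  have -> : be - (s * l) *: x = (be - s *: al) + s *: (al - l *: x).
    by apply: H1R_ext => a; rewrite !H1R_E; ring.
  by apply: Qadd => //; apply: Qscale => //; exact: ltW.
have F2t (t : R) : 0 < t -> F2 (x + t *: be).
  move=> t0; rewrite (faceE _ _ fF2 F2be).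
  have tk : 0 < t + 1 / k by apply: addr_gt0 => //; exact: divr_gt0.
  (* The constant [(t + 1 / k)^-1] makes the first difference a positive multiple of
     [be - k *: x]. *)
  apply: (relint_intro _ Qadd Qscale _ _ (t + 1 / k)^-1 t) => //.
  - by rewrite invr_gt0.
  - have -> : be - (t + 1 / k)^-1 *: (x + t *: be) = (k * (t + 1 / k))^-1 *: (be - k *: x).
      apply: H1R_ext => a; rewrite !H1R_E; field; rewrite !gt_eqF //=.
      by rewrite addr_gt0 // mulr_gt0.
    by apply: Qscale => //; rewrite invr_ge0 mulr_ge0 // ltW.
  - by rewrite addrK.
move=> B; rewrite -[x]addr0 -(scale0r be) => nB.
have [e /= e0 eP] := line_continuous x be 0 _ nB.
exists (x + (e / 2) *: be); split; first by apply: F2t; lra.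
by apply: eP; rewrite /ball /= sub0r normrN gtr0_norm; lra.
Qed.

Lemma face_eq F1 F2 al be : open_face Q F1 -> open_face Q F2 -> F1 al -> F2 be ->
  Ral al = Ral be -> F1 = F2.
Proof.
move=> fF1 fF2 F1al F2be ab.
have Qal : Q al by case: fF1 => [[_ + _ _] _]; exact.
have Qbe : Q be by case: fF2 => [[_ + _ _] _]; exact.
have [s s0 Qs] : exists2 s : R, 0 < s & Q (be - s *: al) by apply/Ral_sub; rewrite ?ab.
have [t t0 Qt] : exists2 t : R, 0 < t & Q (al - t *: be) by apply/Ral_sub; rewrite ?ab.
have F2al : F2 al.
  by rewrite (faceE _ _ fF2 F2be); exact: (relint_intro _ Qadd Qscale _ _ s t).
by rewrite (faceE _ _ fF1 F1al) (faceE _ _ fF2 F2al).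
Qed.

Lemma recurrent_sets_of_faces : (forall al, compact (Ral al)) ->
  (forall al t, phi t @` Ral al = Ral al) ->
  exists RF : set V -> set M,
    [/\ forall F, open_face Q F -> compact (RF F) /\ forall t, phi t @` RF F = RF F,
        forall F, open_face Q F -> forall alpha, F alpha -> Ral alpha = RF F,
        forall F1 F2, open_face Q F1 -> open_face Q F2 ->
          (F1 `<=` closure F2 <-> RF F2 `<=` RF F1) &
        forall F1 F2, open_face Q F1 -> open_face Q F2 ->
          (RF F1 = RF F2 -> F1 = F2) /\
          (F1 `<=` face_boundary F2 -> RF F2 `<` RF F1)].
Proof.
(* Each face receives the recurrent set of a class chosen in it; open faces are non-empty, so the
   default [0] is never taken there. *)
move=> cptR invR; exists (fun F => Ral (xget 0 F)).
have FP F : open_face Q F -> F (xget 0 F).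
  by move=> [[[x Fx] _ _ _] _]; apply: xgetPex; exists x.
split=> [F _|F fF al Fal|F1 F2 fF1 fF2|F1 F2 fF1 fF2].
- by split; [exact: cptR|move=> t; exact: invR].
- have cl : F `<=` closure F by exact: subset_closure.
  by apply/seteqP; split; apply/(face_le F F) => //; exact: FP.
- by apply: face_le => //; exact: FP.
have eqF : Ral (xget 0 F1) = Ral (xget 0 F2) -> F1 = F2.
  by apply: face_eq => //; exact: FP.
split => // bd.
have sub : Ral (xget 0 F2) `<=` Ral (xget 0 F1).
  by apply/(face_le F1 F2) => //; [exact: FP|exact: FP|move=> x /bd[]].
split => // sub'; have F12 : F1 = F2 by apply: eqF; apply/seteqP.
by case: (bd _ (FP _ fF1)) => _; apply; rewrite -F12; exact: FP.
Qed.

End Assembly.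

(* Only needed when [M] is empty, where every class is quasi-Lyapunov. *)
Lemma open_face_setT {R : realType} {M : topologicalType} (F : set (H1R R M)) :
  open_face setT F -> F = setT.
Proof.
move=> [_ /(_ setT)]; move=> <- //; split => //.
- by exists 0.
- by split=> // x y k _ _; exact: mem_set.
- exists setT; first exact: openT.
  by apply/seteqP; split=> // x _; split => //; exact: sub_span.
Qed.

Theorem theorem5p16
  (R : realType) (M : topologicalType)
  (M_manifold : topological_manifold R M)
  (M_compact : compact [set: M])
  (M_connected : connected [set: M])
  (dM : M -> M -> R) (dM_metric : compatible_metric dM)
  (phi : R -> M -> M) (phi_flow : is_flow phi)
  (T : R) (T_gt0 : 0 < T)
  (Mhat : universal_abelian_covering R M)
  (dhat : Mhat -> Mhat -> R)
  (dhat_metric : covering_metric (@uac_proj R M Mhat) dM dhat)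
  (phihat : R -> Mhat -> Mhat)
  (phihat_lift : lifted_flow (@uac_proj R M Mhat) phi phihat)
  (dalpha : forall alpha : H1R R M,
     alpha_covering Mhat alpha -> alpha_covering Mhat alpha -> R)
  (dalpha_metric : forall alpha,
     covering_metric (@alpha_proj R M Mhat alpha) dM (dalpha alpha))
  (phialpha : forall alpha : H1R R M,
     R -> alpha_covering Mhat alpha -> alpha_covering Mhat alpha)
  (phialpha_lift : forall alpha,
     lifted_flow (@alpha_proj R M Mhat alpha) phi (phialpha alpha)) :
  let QL : set (H1R R M) := quasi_Lyapunov phihat dhat T in
  let Ralpha (alpha : H1R R M) : set M :=
    alpha_recurrent (phialpha alpha) (dalpha alpha) T in
  exists RF : set (H1R R M) -> set M,
    [/\ forall F, open_face QL F ->
          compact (RF F) /\ forall t, phi t @` RF F = RF F,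
        forall F, open_face QL F ->
          forall alpha, F alpha -> Ralpha alpha = RF F,
        forall F1 F2, open_face QL F1 -> open_face QL F2 ->
          (F1 `<=` closure F2 <-> RF F2 `<=` RF F1) &
        forall F1 F2, open_face QL F1 -> open_face QL F2 ->
          (RF F1 = RF F2 -> F1 = F2) /\
          (F1 `<=` face_boundary F2 -> RF F2 `<` RF F1)].
Proof.
move=> QL Ralpha.
have cs := uac_cocompact M_compact _ dM_metric _ _ _ T_gt0 _ dhat_metric _ phihat_lift.
have alD al := @class_fun_additive R M al.
pose ngt := nonpos_cycles (act := @uac_act R M Mhat) (psi := phihat) (d := dhat) (T := T).
pose Rc (al : H1R R M) := null_recurrent (act := @uac_act R M Mhat) (psi := phihat) (d :=
    dhat) (T := T) al.
have QLE al : QL al <-> exists2 eps, 0 < eps & ngt eps al.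
  exact: (quasi_Lyapunov_nonpos_cycles cs al (alD al)).
have RE al : Ralpha al = @uac_proj R M Mhat @` Rc al.
  exact: (alpha_recurrentE M_compact _ dM_metric _ _ _ T_gt0 _ dhat_metric _ phihat_lift
    _ _ (dalpha_metric al) _ (phialpha_lift al)).
have ngt_le (e e' : R) al : e <= e' -> ngt e' al -> ngt e al.
  by move=> le h a x xa; apply: (h a x); exact: chain_le le xa.
have QLadd x y : QL x -> QL y -> QL (x + y).
  move=> /QLE[e1 e10 h1] /QLE[e2 e20 h2]; apply/QLE; exists (Num.min e1 e2).
    by rewrite lt_min e10.
  move=> a z za; rewrite H1R_E.
  have xa : x a <= 0 by apply: (ngt_le _ _ _ _ h1 a z za); rewrite ge_min lexx.
  have ya : y a <= 0 by apply: (ngt_le _ _ _ _ h2 a z za); rewrite ge_min lexx orbT.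
  by lra.
have QLscale (k : R) x : 0 <= k -> QL x -> QL (k *: x).
  move=> k0 /QLE[e e0 h]; apply/QLE; exists e => // a z za.
  by apply: mulr_ge0_le0 => //; exact: h za.
have Rsub al be : QL al -> QL be ->
    (Ralpha be `<=` Ralpha al <-> exists2 s : R, 0 < s & QL (be - s *: al)).
  move=> /QLE[e1 e10 h1] /QLE[e2 e20 h2]; rewrite !RE; split=> [sub|[s s0 /QLE[e e0 h]]].
    (* The inclusion of images lifts to the covering, since fibres are orbits and recurrence is
       invariant under the deck group. *)
    have sub' x : Rc be x -> Rc al x.
      move=> rx; have [y ry yx] : (@uac_proj R M Mhat @` Rc al) (uac_proj x).
        by apply: sub; exists x.
      by have [a ->] := uac_act_trans yx; exact: (null_recurrent_act cs).
    have [e e0 null] := null_recurrent_classes cs al be e1 (alD al) e10 h1 sub'.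
    pose m := Num.min e (Num.min e1 e2).
    have m0 : 0 < m by rewrite !lt_min e0 e10.
    have me : m <= e by rewrite ge_min lexx.
    have me1 : m <= e1 by rewrite !ge_min lexx orbT.
    have me2 : m <= e2 by rewrite !ge_min lexx !orbT.
    have [s [del [s0 del0 hs]]] := nonpos_cycles_sub cs m al be m0 (alD al) (alD be)
      (ngt_le _ _ _ me1 h1) (ngt_le _ _ _ me2 h2)
      (fun a x xa => null a x (chain_le _ _ _ _ _ _ _ me xa)).
    by exists s => //; apply/QLE; exists del.
  move=> _ [x rx <-]; exists x => //.
  have m0 : 0 < Num.min e e1 by rewrite lt_min e0.
  apply: (null_recurrent_incl al be s _ x s0 m0 _ _ rx).
    by apply: (ngt_le _ _ _ _ h1); rewrite ge_min lexx orbT.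
  by apply: (ngt_le _ _ (be - s *: al) _ h); rewrite ge_min lexx.
have [faceE face_closed] : (forall F be, open_face QL F -> F be -> F = relint QL be) /\
    (forall F, open_face QL F -> closure F `<=` linear_span F).
  have [[x0 _]|noM] := pselect (exists x : Mhat, True).
    have [s gen] := finitely_generated x0 cs (uac_connected (u := Mhat)).
    have sep (u : H1R R M) : (forall g, g \in s -> u g = 0) -> u = 0.
      move=> us; apply: H1R_ext; apply: gen => [|g a gs ua|g a gs].
      - by apply: (addrI (u 0)); rewrite -alD !addr0.
      - by rewrite alD ua (us _ gs) addr0.
      - by rewrite alD (us _ gs) addr0.
    split=> [F be fF Fbe|F _]; last exact: (closure_span s sep).
    exact: (open_face_relint s sep _ QLadd QLscale).
  have QLT : QL = setT.
    apply/seteqP; split=> // al _; apply/QLE; exists 1 => // a x.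
    by exfalso; apply: noM; exists x.
  rewrite QLT; split=> [F be /open_face_setT -> _|F /open_face_setT ->].
    by apply/seteqP; split=> // x _; exists 1.
  by move=> x _; exact: sub_span.
apply: recurrent_sets_of_faces => // al.
  by rewrite RE; exact:
      (null_recurrent_image_compact M_compact _ dM_metric _ _ _ T_gt0 _ dhat_metric _ phihat_lift).
by move=> t; rewrite RE; exact:
    (null_recurrent_image_invariant M_compact _ dM_metric _ _ _ T_gt0 _ dhat_metric _ phihat_lift).
Qed.
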